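(* Let $P$ be the uniform distribution on the square region $J=[0,1]\times[0,1]$. Assume that every optimal set of three-means for $P$ is symmetric with respect to (i.e. invariant under reflection in) one of the two diagonals of the square or one of the two lines $x_1=\frac12$, $x_2=\frac12$. Then there are exactly four optimal sets of three-means for $P$, the quantization error is $V_3(P)=0.0661797$ (decimal approximation, i.e. $|V_3(P)-0.0661797|<10^{-7}$), and one of the four optimal sets of three-means is, with coordinates given as decimal approximations (each within $10^{-6}$), the set $\{(0.5,\,0.803764),\ (0.231591,\,0.317285),\ (0.768409,\,0.317285)\}$.
   Context: The uniform distribution on $J$ is the Borel probability measure with density $1$ on $J$ and $0$ elsewhere with respect to Lebesgue measure. For a Borel probability measure $P$ on $\mathbb R^d$ and $n\ge1$, the $n$th quantization error is $V_n(P)=\inf\{\int \min_{a\in\alpha}\|x-a\|^2\,dP(x):\alpha\subset\mathbb R^d,\ \mathrm{card}(\alpha)\le n\}$, where $\|\cdot\|$ is the Euclidean norm. A set $\alpha$ with $\mathrm{card}(\alpha)\le n$ attaining the infimum is called an optimal set of $n$-means; for absolutely continuous $P$ it has exactly $n$ elements. *)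

(* Defs.v *)
(* MathComp-Analysis *)
From HB Require Import structures.
From mathcomp Require Import all_boot all_order all_algebra.
From mathcomp Require Import all_classical all_reals all_analysis measurable_realfun.

Set Implicit Arguments.
Unset Strict Implicit.
Unset Printing Implicit Defensive.

Import Order.TTheory GRing.Theory Num.Theory.
Import numFieldNormedType.Exports.
Local Open Scope classical_set_scope.
Local Open Scope ring_scope.

(* R^2 with its Borel sigma-algebra; measurableTypeR R is R itself, with the
   measurable structure that carries lebesgue_measure. *)
Notation plane R := (measurableTypeR R * measurableTypeR R)%type.

Section quantization.
Context {R : realType}.
Implicit Types (P : probability (plane R) R) (x a : R * R) (n : nat)
  (alpha : set (R * R)).

(* The library's own norm on R * R is the sup norm. *)
Definition enorm x : R := Num.sqrt (x.1 ^+ 2 + x.2 ^+ 2).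

(* For a nonempty finite alpha the infimum in the integrand is a minimum; for
   alpha = set0 it is +oo, so the empty set never competes in quant_error
   when n >= 1. *)
Definition distortion P alpha : \bar R :=
  (\int[P]_x ereal_inf [set (enorm (x - a) ^+ 2)%:E | a in alpha])%E.

Definition quant_error n P : \bar R :=
  ereal_inf [set distortion P alpha | alpha in
               [set alpha | (alpha #<= `I_n)%card]].

Definition optimal_set n P alpha : Prop :=
  (alpha #<= `I_n)%card /\ distortion P alpha = quant_error n P.

End quantization.

Section uniform_on_square.
Context (R : realType).

Definition unit_square : set (R * R) := `[0, 1]%classic `*` `[0, 1]%classic.

Local Notation mu := (@lebesgue_measure R).
Local Notation leb2 := (mu \x mu)%E.

Definition unif_square (A : set (plane R)) : \bar R :=
  (\int[leb2]_(x in A) (\1_unit_square x)%:E)%E.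

Let measurable_unit_square : @measurable _ (plane R) unit_square.
Proof. by apply: measurableX; exact: measurable_itv. Qed.

Let measurable_density :
  measurable_fun setT (fun x : plane R => (\1_unit_square x : R)%:E).
Proof. by apply/measurable_EFinP; exact: measurable_indic. Qed.

Let unif0 : unif_square set0 = 0%E.
Proof. by rewrite /unif_square integral_set0. Qed.

Let unif_ge0 A : (0 <= unif_square A)%E.
Proof. by apply: integral_ge0 => x _; rewrite lee_fin. Qed.

Let unif_sigma_additive : semi_sigma_additive unif_square.
Proof.
move=> /= F mF tF mUF; rewrite /unif_square; apply: cvg_toP.
  apply: ereal_nondecreasing_is_cvgn => m n mn.
  apply: lee_sum_nneg_natr => // k _ _.
  by apply: integral_ge0 => /= x Fkx; rewrite lee_fin.
rewrite ge0_integral_bigcup//=.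
exact: measurable_funS measurable_density.
Qed.

HB.instance Definition _ := isMeasure.Build _ _ _ unif_square
  unif0 unif_ge0 unif_sigma_additive.

Let unif_setT : unif_square [set: _] = 1%E.
Proof.
transitivity (leb2 unit_square).
  by rewrite /unif_square integral_indic// setIT.
rewrite product_measure1E; [|exact: measurable_itv|exact: measurable_itv].
have I01 : mu `[0, 1]%classic = 1%E.
  by rewrite lebesgue_measure_itv/= lte_fin ltr01 oppr0 adde0.
by rewrite -[RHS]mule1; congr (_ * _)%E; exact: I01.
Qed.

HB.instance Definition _ := @Measure_isProbability.Build _ _ R
  unif_square unif_setT.

End uniform_on_square.
Arguments unif_square : clear implicits.

(* decimal [:: d_1; d_2; ...; d_k] = 0.d_1d_2...d_k *)
Definition decimal {R : realType} (s : seq nat) : R :=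
  foldr (fun (d : nat) (x : R) => (d%:R + x) / 10) 0 s.

Section symmetries.
Context {R : realType}.
Implicit Types (x : R * R) (alpha : set (R * R)).

Definition refl_diag x : R * R := (x.2, x.1).
Definition refl_antidiag x : R * R := (1 - x.2, 1 - x.1).
(* reflections in the lines x_1 = 1/2 and x_2 = 1/2 *)
Definition refl_vert x : R * R := (1 - x.1, x.2).
Definition refl_horiz x : R * R := (x.1, 1 - x.2).

Definition square_symmetric alpha : Prop :=
  [\/ refl_diag @` alpha = alpha, refl_antidiag @` alpha = alpha,
      refl_vert @` alpha = alpha | refl_horiz @` alpha = alpha].

Definition near_pt (e : R) (x y : R * R) : Prop :=
  `|x.1 - y.1| < e /\ `|x.2 - y.2| < e.

End symmetries.

(* Main.v *)
(* A symmetric optimal triple is p, q, q' with p on the axis and q, q' mirror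
   images of each other: if the three points are collinear, the distortion is at
   least 1/12, which is too large.

   Axis x_1 = 1/2, with p above q.  Let c(x_1) be the height below which q or q'
   is nearer than p.  The distortion is a quadratic polynomial in the
   coordinates of p and q whose coefficients are the moments E c, E c^2 and
   E (|x_1 - 1/2| c), and minimizing over p and q for a fixed c leaves a
   function of these moments.  By Cauchy-Schwarz the second moment can be
   eliminated, with equality when c is affine, whatever sides of the square the
   bisector crosses.  What remains is the maximization of a rational function
   [gain w d], strongly concave near its unique maximum; the second order
   expansion of the gain at a rational point locates that maximum.

   Diagonal axis.  On half of the square the bisector of p and q cuts off a
   triangle at a vertex, so the distortion is a quadratic polynomial in the
   coordinates of p and q minus a rational function; completing squares leaves
   polynomial inequalities in the two fractions of the sides that are cut off.
   They give a distortion of at least 31/468 > 0.0662, more than what the other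
   axis achieves. *)
Require Import Defs.
From Stdlib Require Import ZArith.
From mathcomp Require Import all_boot all_order all_algebra.
From mathcomp Require Import all_classical all_reals all_analysis measurable_realfun.
From mathcomp Require Import ring lra ssrZ.

Import Order.TTheory GRing.Theory Num.Theory.
Import numFieldNormedType.Exports.
Local Open Scope classical_set_scope.
Local Open Scope ring_scope.

(** * Integrals over intervals *)

Section interval_integrals.
Context {R : realType}.
Notation mu := (@lebesgue_measure R).
Implicit Types (a b c u v : R) (f g : R -> R) (n : nat).

(** The cells of a triple depend on its points, and the bisector may cross any sides of the square.
    To avoid a case analysis the cost is decoupled from the cells: when the part below an arbitrary
    threshold is served by the pair and the rest by the axis point, the cost is at least the
    distortion, with equality for the bisector. The moments of the true threshold thus bound the
    distortion of an optimal triple from below, and the affine threshold with the same [w] and [d]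
    bounds it from above; optimality forces equality everywhere. The affine competitor is available
    only if it stays between 0 and 1, which is why the moments are confined to a box beforehand. The
    maximizer of [gain] is never constructed: compactness provides an optimal triple, its moments
    are a maximizer, and strong concavity makes it unique, so that all four sets and all decimals
    come from one point. The diagonal axis is treated in the same spirit: the two cut fractions
    become free parameters once the saving is written as an integral over the cut triangle. *)

Definition itv_int a b f : R := \int[mu]_(x in `[a, b]) f x.

Definition pos_part (r : R) : R := Num.max r 0.

Lemma affine_continuous u v : continuous (fun y : R => u + v * y).
Proof.
by move=> x; apply: cvgD; [exact: cvg_cst|apply: cvgM; [exact: cvg_cst|exact: cvg_id]].
Qed.

Lemma itv_int_point a f : itv_int a a f = 0.
Proof. by rewrite /itv_int set_itv1 Rintegral_set1. Qed.

Lemma continuous_integrable_itv a b f : continuous f ->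
  mu.-integrable `[a, b] (EFin \o f).
Proof.
move=> cf; apply: continuous_compact_integrable; first exact: segment_compact.
exact: continuous_subspaceT.
Qed.

Lemma itv_int_split a c b f : a <= c <= b -> mu.-integrable `[a, b] (EFin \o f) ->
  itv_int a b f = itv_int a c f + itv_int c b f.
Proof.
move=> /andP[ac cb] fi; rewrite /itv_int.
have := @Rintegral_itvB _ f (BLeft a) (BRight b) c fi.
rewrite !bnd_simp => /(_ ac cb) E.
rewrite -[X in _ = _ + X]Rintegral_itv_obnd_cbnd; last first.
  apply: integrableS fi => //; apply: subset_itv => //=.
by rewrite -E addrC subrK.
Qed.

Lemma itv_int_affine_pow a b u v n : a <= b -> v != 0 ->
  itv_int a b (fun y => (u + v * y) ^+ n) =
  ((u + v * b) ^+ n.+1 - (u + v * a) ^+ n.+1) / (n.+1%:R * v).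
Proof.
rewrite le_eqVlt => /predU1P[->|ab] v0.
  by rewrite itv_int_point subrr mul0r.
pose F y := (u + v * y) ^+ n.+1 / (n.+1%:R * v).
have dF (x : R) : is_derive x 1 F ((u + v * x) ^+ n).
  have -> : F = (n.+1%:R * v)^-1 \*: (cst u + v \*: id) ^+ n.+1.
    by apply/funext => y; rewrite /F !fctE /GRing.scale /= mulrC.
  have d1 : is_derive x 1 (cst u + v \*: id) (0 + v *: 1).
    by apply: is_deriveD; apply: is_deriveZ.
  apply: (is_derive_eq (is_deriveZ _ (is_deriveX n.+1 d1))).
  rewrite /GRing.scale /=.
  rewrite !fctE.
  rewrite add0r mulr1.
  have : n.+1%:R != 0 :> R by rewrite pnatr_eq0.
  by move: (n.+1%:R : R) ((u + v * x) ^+ n) => m w m0; field; rewrite v0 m0.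
have dFx (y : R) : derivable F y 1 by have [] := dF y.
have cF : continuous F.
  move=> y; apply/differentiable_continuous/derivable1_diffP; exact: dFx.
rewrite /itv_int /Rintegral (@continuous_FTC2 _ _ F)//=.
- by rewrite mulrBl.
- apply: continuous_subspaceT => y; apply: (@continuous_comp _ _ _ (fun z => u + v * z) (fun z => z ^+ n)).
    exact: affine_continuous.
  exact: exprn_continuous.
- split.
  + by move=> y _; exact: dFx.
  + by apply: cvg_at_right_filter; exact: cF.
  + by apply: cvg_at_left_filter; exact: cF.
- by move=> y _; rewrite derive1E; have [_ ->] := dF y.
Qed.

Lemma eq_itv_int a b f g : (forall y, a <= y <= b -> f y = g y) ->
  itv_int a b f = itv_int a b g.
Proof.
by move=> fg; apply: eq_Rintegral => y; rewrite inE /= in_itv /=; exact: fg.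
Qed.

Lemma le_itv_int a b f g :
  mu.-integrable `[a, b] (EFin \o f) -> mu.-integrable `[a, b] (EFin \o g) ->
  (forall y, a <= y <= b -> f y <= g y) -> itv_int a b f <= itv_int a b g.
Proof.
move=> fi gi fg; apply: le_Rintegral => // y /=; rewrite in_itv /=; exact: fg.
Qed.

Lemma itv_int_cst a b u : a <= b -> itv_int a b (fun=> u) = u * (b - a).
Proof.
move=> ab; rewrite /itv_int Rintegral_cst//= lebesgue_measure_itv /= lte_fin.
have [//|ba] := ltP a b.
by have -> : a = b; [apply/eqP; rewrite eq_le ab ba|rewrite subrr].
Qed.

Lemma itv_intD a b f g :
  mu.-integrable `[a, b] (EFin \o f) -> mu.-integrable `[a, b] (EFin \o g) ->
  itv_int a b (fun y => f y + g y) = itv_int a b f + itv_int a b g.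
Proof. by move=> fi gi; rewrite /itv_int RintegralD. Qed.

Lemma itv_intZ a b u f : mu.-integrable `[a, b] (EFin \o f) ->
  itv_int a b (fun y => u * f y) = u * itv_int a b f.
Proof. by move=> fi; rewrite /itv_int RintegralZl. Qed.

Lemma pos_part_ge0 (r : R) : 0 <= r -> pos_part r = r.
Proof. by move=> r0; rewrite /pos_part; apply/max_idPl. Qed.

Lemma pos_part_le0 (r : R) : r <= 0 -> pos_part r = 0.
Proof. by move=> r0; rewrite /pos_part; apply/max_idPr. Qed.

Lemma pos_part_nneg (r : R) : 0 <= pos_part r.
Proof. by rewrite /pos_part le_max lexx orbT. Qed.

Lemma continuous_pos_part f : continuous f -> continuous (fun y => pos_part (f y)).
Proof.
by move=> cf x; apply: continuous_max; [exact: cf|exact: cst_continuous].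
Qed.

Lemma continuous_pow f n : continuous f -> continuous (fun y => f y ^+ n).
Proof.
move=> cf y; apply: (@continuous_comp _ _ _ f (fun z => z ^+ n)); first exact: cf.
exact: exprn_continuous.
Qed.

Lemma affine_root a b u v : a <= b -> v != 0 ->
  (0 <= u + v * a /\ u + v * b <= 0) \/ (u + v * a <= 0 /\ 0 <= u + v * b) ->
  exists r, u + v * r = 0 /\ a <= r <= b.
Proof.
move=> ab v0 uab; exists (- u / v); split; first by field.
case: (ltgtP v 0) v0 => // v1 _.
- have vab : v * b <= v * a by rewrite ler_wnM2l// ltW.
  by rewrite ler_ndivlMr// ler_ndivrMr//; apply/andP; case: uab => -[]; split; lra.
- have vab : v * a <= v * b by rewrite ler_wpM2l// ltW.
  by rewrite ler_pdivlMr// ler_pdivrMr//; apply/andP; case: uab => -[]; split; lra.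
Qed.

(** The antiderivative of the affine power stays valid with [pos_part] inside, for either sign of
    [v]; splitting at the root reduces to the affine case. The exponent is a successor because a
    zeroth power would be 1 even where the positive part vanishes. *)
Lemma itv_int_pos_affine_pow a b u v n : a <= b -> v != 0 ->
  itv_int a b (fun y => pos_part (u + v * y) ^+ n.+1) =
  (pos_part (u + v * b) ^+ n.+2 - pos_part (u + v * a) ^+ n.+2) / (n.+2%:R * v).
Proof.
move=> ab v0.
have ends c d : c <= d -> (0 <= u + v * c /\ 0 <= u + v * d) \/
    (u + v * c <= 0 /\ u + v * d <= 0) ->
    itv_int c d (fun y => pos_part (u + v * y) ^+ n.+1) =
    (pos_part (u + v * d) ^+ n.+2 - pos_part (u + v * c) ^+ n.+2) / (n.+2%:R * v).
  move=> cd [] [uc ud].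
    rewrite !pos_part_ge0// -itv_int_affine_pow//; apply: eq_itv_int => y /andP[cy yd].
    rewrite pos_part_ge0//; have [v1|v1] := leP 0 v; nra.
  rewrite !pos_part_le0// !expr0n /= subrr mul0r.
  rewrite (@eq_itv_int _ _ _ (fun=> 0)) ?itv_int_cst ?mul0r//= => y /andP[cy yd].
  rewrite pos_part_le0 ?expr0n//; have [v1|v1] := leP 0 v; nra.
have [ua|/ltW ua] := leP 0 (u + v * a); have [ub|/ltW ub] := leP 0 (u + v * b);
  try solve [apply: ends => //; by left|apply: ends => //; by right].
all: have [r [ur /andP[ar rb]]] : exists r, u + v * r = 0 /\ a <= r <= b by
  by apply: (affine_root _ _ _ _ ab v0); first [by left|by right].
all: rewrite (itv_int_split a r); [|by rewrite ar|
  by apply/continuous_integrable_itv/continuous_pow/continuous_pos_part/affine_continuous].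
all: rewrite (ends a r) ?(ends r b) ?ur//; try first [by left|by right|by left; split; rewrite ?ur|by right; split; rewrite ?ur].
all: by rewrite (@pos_part_le0 0)// expr0n /= subr0 sub0r -mulrDl addrC.
Qed.

Lemma itv_int_id a b : a <= b -> itv_int a b id = (b ^+ 2 - a ^+ 2) / 2.
Proof.
move=> ab; have := @itv_int_affine_pow a b 0 1 1%N ab (oner_neq0 _).
rewrite !add0r !mul1r mulr1 => <-; apply: eq_itv_int => y _.
by rewrite add0r mul1r expr1.
Qed.

Lemma itv_int_sqr a b : a <= b ->
  itv_int a b (fun y => y ^+ 2) = (b ^+ 3 - a ^+ 3) / 3.
Proof.
move=> ab; have := @itv_int_affine_pow a b 0 1 2%N ab (oner_neq0 _).
rewrite !add0r !mul1r mulr1 => <-; apply: eq_itv_int => y _.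
by rewrite add0r mul1r.
Qed.

End interval_integrals.

(** * Integrals over the square *)

Section square_integrals.
Context {R : realType}.
Notation mu := (@lebesgue_measure R).
Notation leb2 := (mu \x mu)%E.
Implicit Types (f g : R * R -> R) (M : R).

Definition sq_int f : R := itv_int 0 1 (fun x => itv_int 0 1 (fun y => f (x, y))).

(** These conditions make the iterated real integrals finite and Tonelli's theorem applicable. The
    bound is asked only on the square, since squared distances are unbounded on the plane. *)
Definition sq_bounded f : Prop :=
  [/\ measurable_fun (setT : set (plane R)) f, forall z, 0 <= f z &
  exists M, forall x y : R, 0 <= x <= 1 -> 0 <= y <= 1 -> f (x, y) <= M].

Lemma bounded_integrable_itv (h : R -> R) M :
  measurable_fun (`[0, 1]%classic : set (measurableTypeR R)) h -> (forall x, 0 <= x <= 1 -> `|h x| <= M) ->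
  mu.-integrable `[0, 1] (EFin \o h).
Proof.
move=> mh hM; apply: measurable_bounded_integrable => //.
  by rewrite /= lebesgue_measure_itv /= lte_fin ltr01 oppr0 adde0 ltry.
exists M; split; first exact: num_real.
move=> M' MM' x /=; rewrite in_itv /= => x01.
exact: le_trans (hM _ x01) (ltW MM').
Qed.

Let msq : measurable (@unit_square R : set (plane R)).
Proof. by apply: measurableX; exact: measurable_itv. Qed.

Lemma unif_square_sub (A : set (plane R)) : measurable A -> A `<=` (@unit_square R) ->
  unif_square R A = leb2 A.
Proof.
move=> mA AS; rewrite /unif_square integral_indic//.
congr (leb2 _); apply/seteqP; split => [x []//|x Ax]; split => //; exact: AS.
Qed.

(** The complement of the square is negligible for [unif_square], and on measurable subsets of the
    square this measure agrees with Lebesgue measure. *)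
Lemma unif_integral_square f : measurable_fun (setT : set (plane R)) f ->
  (forall z, 0 <= f z) ->
  (\int[unif_square R]_z (f z)%:E = \int[leb2]_(z in @unit_square R) (f z)%:E)%E.
Proof.
move=> mf f0; have mN : measurable (~` @unit_square R : set (plane R)) by exact: measurableC.
have N0 : unif_square R (~` @unit_square R) = 0%E.
  by rewrite /unif_square integral_indic//= setICr measure0.
have mE : measurable_fun (setT : set (plane R)) (fun z => (f z)%:E) by exact/measurable_EFinP.
rewrite (ge0_negligible_integral mN _ mE _ N0)//=; last first.
  by move=> x _; rewrite lee_fin.
rewrite setTD setCK; apply: eq_measure_integral => A mA AS.
exact: unif_square_sub.
Qed.

(** Passage from the abstract integral to iterated real integrals. The last item compares the two
    orders of integration in Tonelli's theorem. *)
Lemma unif_integralE f : sq_bounded f ->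
  [/\ (\int[unif_square R]_z (f z)%:E = (sq_int f)%:E)%E,
      (forall x, 0 <= x <= 1 -> mu.-integrable `[0, 1] (fun y => (f (x, y))%:E)),
      mu.-integrable `[0, 1] (fun x => (itv_int 0 1 (fun y => f (x, y)))%:E) &
      sq_int (f \o refl_diag) = sq_int f].
Proof.
move=> [mf f0 [M fM]].
pose F := (EFin \o f) \_ (@unit_square R).
have mF : measurable_fun (setT : set (plane R)) F.
  apply/(measurable_restrictT _ msq); apply/measurable_EFinP; exact: measurable_funTS.
have F0 z : (0 <= F z)%E by rewrite /F patchE; case: ifP => //= _; rewrite lee_fin.
have mfx x : measurable_fun (`[0, 1]%classic : set (measurableTypeR R)) (fun y => f (x, y)).
  by apply: measurable_funTS; exact: measurableT_comp.
have mfy y : measurable_fun (`[0, 1]%classic : set (measurableTypeR R)) (fun x => f (x, y)).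
  by apply: measurable_funTS; exact: measurableT_comp.
have ifx x : 0 <= x <= 1 -> mu.-integrable `[0, 1] (fun y => (f (x, y))%:E).
  move=> x01; apply: (@bounded_integrable_itv _ M) => // y y01.
  by rewrite ger0_norm// fM.
have ify y : 0 <= y <= 1 -> mu.-integrable `[0, 1] (fun x => (f (x, y))%:E).
  move=> y01; apply: (@bounded_integrable_itv _ M) => // x x01.
  by rewrite ger0_norm// fM.
pose phi x := itv_int 0 1 (fun y => f (x, y)).
pose psi y := itv_int 0 1 (fun x => f (x, y)).
have sqE x y : ((x, y) \in @unit_square R) = (x \in `[0, 1]%classic) && (y \in `[0, 1]%classic).
  by apply/idP/andP; rewrite !inE.
have EFx : @fubini_F _ _ (measurableTypeR R) (measurableTypeR R) R mu F = (EFin \o phi) \_ `[0, 1].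
  apply/funext => x; rewrite /fubini_F [RHS]patchE; case: ifPn => x01.
    have x01' : 0 <= x <= 1 by move: x01; rewrite inE /= in_itv.
    rewrite /= /phi /itv_int /Rintegral fineK; last exact: integrable_fin_num (ifx x x01').
    rewrite [RHS]integral_mkcond; apply: eq_integral => y _.
    by rewrite /F !patchE sqE x01.
  by apply: integral0_eq => y _; rewrite /F patchE sqE (negbTE x01).
have EFy : @fubini_G _ _ (measurableTypeR R) (measurableTypeR R) R mu F = (EFin \o psi) \_ `[0, 1].
  apply/funext => y; rewrite /fubini_G [RHS]patchE; case: ifPn => y01.
    have y01' : 0 <= y <= 1 by move: y01; rewrite inE /= in_itv.
    rewrite /= /psi /itv_int /Rintegral fineK; last exact: integrable_fin_num (ify y y01').
    rewrite [RHS]integral_mkcond; apply: eq_integral => x _.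
    by rewrite /F !patchE sqE y01 andbT.
  by apply: integral0_eq => x _; rewrite /F patchE sqE (negbTE y01) andbF.
have bnd (h : R -> R) : (forall y, 0 <= h y) -> (forall y, 0 <= y <= 1 -> h y <= M) ->
    mu.-integrable `[0, 1] (EFin \o h) -> `|itv_int 0 1 h| <= M.
  move=> h0 hM hi; rewrite ger0_norm; last by apply: Rintegral_ge0.
  apply: le_trans (le_itv_int _ _ _ (fun=> M) hi _ hM) _.
    by apply: continuous_integrable_itv; exact: cst_continuous.
  by rewrite itv_int_cst// subr0 mulr1.
have iphi : mu.-integrable `[0, 1] (EFin \o phi).
  apply: (@bounded_integrable_itv _ M).
    apply/measurable_EFinP/measurable_restrictT => //.
    by rewrite -EFx; exact: measurable_fun_fubini_tonelli_F.
  by move=> x x01; apply: bnd => //; [move=> y y01; exact: fM|exact: ifx].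
have ipsi : mu.-integrable `[0, 1] (EFin \o psi).
  apply: (@bounded_integrable_itv _ M).
    apply/measurable_EFinP/measurable_restrictT => //.
    by rewrite -EFy; exact: measurable_fun_fubini_tonelli_G.
  by move=> y y01; apply: bnd => //; [move=> x x01; exact: fM|exact: ify].
have E1 : (\int[leb2]_(z in @unit_square R) (f z)%:E = (sq_int f)%:E)%E.
  rewrite integral_mkcond fubini_tonelli1// EFx -integral_mkcond.
  by rewrite /sq_int /itv_int /Rintegral fineK//; exact: integrable_fin_num.
have E2 : (\int[leb2]_(z in @unit_square R) (f z)%:E = (sq_int (f \o refl_diag))%:E)%E.
  rewrite integral_mkcond fubini_tonelli2// EFy -integral_mkcond.
  by rewrite /sq_int /itv_int /Rintegral fineK//; exact: integrable_fin_num.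
split; [exact: etrans (unif_integral_square _ mf f0) E1|exact: ifx|exact: iphi|].
by apply: EFin_inj; exact: etrans (esym E2) E1.
Qed.

End square_integrals.

(** * Distortion of three points: reflections and collinear triples *)

Section three_point_distortion.
Context {R : realType}.
Notation mu := (@lebesgue_measure R).
Implicit Types (f g : R * R -> R) (M k : R) (a b c z : R * R).

Lemma sq_boundedD {f g} : sq_bounded f -> sq_bounded g ->
  sq_bounded (fun z => f z + g z).
Proof.
move=> [mf f0 [M fM]] [mg g0 [N gN]]; split.
- exact: measurable_funD.
- by move=> z; rewrite addr_ge0.
- by exists (M + N) => x y x01 y01; rewrite lerD ?fM ?gN.
Qed.

Lemma sq_bounded_cst k : 0 <= k -> sq_bounded (fun=> k).
Proof. by move=> k0; split => //; exists k. Qed.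

Lemma sq_bounded_min {f g} : sq_bounded f -> sq_bounded g ->
  sq_bounded (fun z => Num.min (f z) (g z)).
Proof.
move=> [mf f0 [M fM]] [mg g0 [N gN]]; split.
- exact: measurable_minr.
- by move=> z; rewrite le_min f0 g0.
- by exists M => x y x01 y01; rewrite ge_min fM.
Qed.

Lemma sq_intD {f g} : sq_bounded f -> sq_bounded g ->
  sq_int (fun z => f z + g z) = sq_int f + sq_int g.
Proof.
move=> /unif_integralE[_ fy fx _] /unif_integralE[_ gy gx _].
rewrite /sq_int -itv_intD//; apply: eq_itv_int => x x01.
by rewrite itv_intD//; [exact: fy|exact: gy].
Qed.

Lemma le_sq_int {f g} : sq_bounded f -> sq_bounded g ->
  (forall x y, 0 <= x <= 1 -> 0 <= y <= 1 -> f (x, y) <= g (x, y)) ->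
  sq_int f <= sq_int g.
Proof.
move=> /unif_integralE[_ fy fx _] /unif_integralE[_ gy gx _] fg.
apply: le_itv_int => // x x01; apply: le_itv_int => [||y y01].
- exact: fy.
- exact: gy.
- exact: fg.
Qed.

Lemma sq_int_cst k : sq_int (fun=> k) = k.
Proof. by rewrite /sq_int !itv_int_cst//; lra. Qed.

Lemma itv_int_quadratic (u v w : R) :
  itv_int 0 1 (fun y => u + v * y + w * y ^+ 2) = u + v / 2 + w / 3.
Proof.
have cid : continuous (@id R) by move=> x; exact: cvg_id.
have cm (h : R -> R) k : continuous h -> continuous (fun y => k * h y).
  by move=> ch x; apply: cvgM; [exact: cvg_cst|exact: ch].
rewrite itv_intD; last 2 first.
- exact: (continuous_integrable_itv _ _ _ (affine_continuous u v)).
- exact/continuous_integrable_itv/cm/continuous_pow.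
rewrite itv_intD; last 2 first.
- by apply: continuous_integrable_itv; exact: cst_continuous.
- exact/continuous_integrable_itv/cm.
rewrite !itv_intZ; last 2 first.
- exact/continuous_integrable_itv/continuous_pow.
- exact/continuous_integrable_itv.
by rewrite itv_int_cst// itv_int_id// itv_int_sqr//; field.
Qed.

Definition sqdist z a : R := (z.1 - a.1) ^+ 2 + (z.2 - a.2) ^+ 2.

Definition nearest3 a b c z : R :=
  Num.min (Num.min (sqdist z a) (sqdist z b)) (sqdist z c).

Definition dist3 a b c : R := sq_int (nearest3 a b c).

(** Sums of two such squares give squared distances to points, and single ones give squared
    distances to lines. *)
Lemma sq_bounded_sqr (u v w : R) : sq_bounded (fun z => (u * z.1 + v * z.2 + w) ^+ 2).
Proof.
split.
- apply: measurable_funX; apply: measurable_funD => //; apply: measurable_funD;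
    exact: measurable_funM.
- by move=> z; exact: sqr_ge0.
- exists ((`|u| + `|v| + `|w|) ^+ 2) => x y /= /andP[x0 x1] /andP[y0 y1].
  rewrite -(real_normK (num_real (u * x + v * y + w))) lerXn2r// ?nnegrE//.
  apply: (le_trans (ler_normD _ _)); rewrite lerD2r.
  apply: (le_trans (ler_normD _ _)); rewrite !normrM (ger0_norm x0) (ger0_norm y0).
  by rewrite lerD// ler_piMr.
Qed.

Lemma sq_bounded_sqdist a : sq_bounded (sqdist ^~ a).
Proof.
have := sq_boundedD (sq_bounded_sqr 1 0 (- a.1)) (sq_bounded_sqr 0 1 (- a.2)).
by congr sq_bounded; apply/funext => z; rewrite !mul0r !mul1r add0r addr0.
Qed.

Lemma sq_bounded_nearest3 a b c : sq_bounded (nearest3 a b c).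
Proof. by do !apply: sq_bounded_min; exact: sq_bounded_sqdist. Qed.

Lemma enorm_sqr z a : enorm (z - a) ^+ 2 = sqdist z a.
Proof. by rewrite /enorm sqr_sqrtr// addr_ge0 ?sqr_ge0. Qed.

Lemma distortion3 a b c : distortion (unif_square R) [set a; b; c] = (dist3 a b c)%:E.
Proof.
have [<- _ _ _] := unif_integralE _ (sq_bounded_nearest3 a b c).
apply: eq_integral => z _; apply/le_anti/andP; split; last first.
  apply: le_ereal_inf_tmp => _ [e + <-]; rewrite lee_fin enorm_sqr.
  by move=> [[->|->]|->]; rewrite /nearest3 !ge_min lexx ?orbT.
rewrite /nearest3 !EFin_min !le_min -!andbA; apply/and3P; split;
  apply: ereal_inf_lbound.
- by exists a; [left; left|rewrite enorm_sqr].
- by exists b; [left; right|rewrite enorm_sqr].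
- by exists c; [right|rewrite enorm_sqr].
Qed.

Lemma sq_int_swap f : sq_bounded f -> sq_int (fun z => f (z.2, z.1)) = sq_int f.
Proof. by case/unif_integralE. Qed.

Lemma sq_int_flip f : (forall x, continuous (fun y => f (x, y))) ->
  sq_int (fun z => f (z.1, 1 - z.2)) = sq_int f.
Proof.
move=> cf; apply: eq_itv_int => x _; rewrite /itv_int.
rewrite [RHS]Rintegration_by_substitution_onem.
- by rewrite unstable.onem1.
- by rewrite ler01 lexx.
- exact: continuous_subspaceT.
Qed.

Lemma dist3_swap a b c : dist3 (refl_diag a) (refl_diag b) (refl_diag c) = dist3 a b c.
Proof.
rewrite -[RHS]sq_int_swap; last exact: sq_bounded_nearest3.
by apply: eq_itv_int => x _; apply: eq_itv_int => y _;
  rewrite /nearest3 /sqdist /= ![(x - _) ^+ 2 + _]addrC.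
Qed.

Lemma continuous_sqdist x a : continuous (fun y => sqdist (x, y) a).
Proof.
move=> y; rewrite /sqdist /=; apply: cvgD; first exact: cvg_cst.
apply: (continuous_pow (fun y => y - a.2) 2) => z.
by apply: cvgB; [exact: cvg_id|exact: cvg_cst].
Qed.

Lemma dist3_flip a b c :
  dist3 (refl_horiz a) (refl_horiz b) (refl_horiz c) = dist3 a b c.
Proof.
have cm (f g : R -> R) : continuous f -> continuous g ->
    continuous (fun y => Num.min (f y) (g y)).
  by move=> cf cg y; apply: continuous_min; [exact: cf|exact: cg].
rewrite -[RHS]sq_int_flip; last first.
  by move=> x; exact: (cm _ _ (cm _ _ (continuous_sqdist x a) (continuous_sqdist x b))
    (continuous_sqdist x c)).
have E (x y p : R) : (x - (1 - y)) ^+ 2 = (1 - x - y) ^+ 2 by ring.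
by apply: eq_itv_int => x _; apply: eq_itv_int => y _;
  rewrite /nearest3 /sqdist /= !E.
Qed.

Lemma sq_int_sqr (u v w : R) : sq_int (fun z => (u * z.1 + v * z.2 + w) ^+ 2) =
  (u ^+ 2 + v ^+ 2) / 3 + u * v / 2 + w * (u + v) + w ^+ 2.
Proof.
pose h x := (w ^+ 2 + v * w + v ^+ 2 / 3) + (2 * u * w + u * v) * x + u ^+ 2 * x ^+ 2.
transitivity (itv_int 0 1 h); last by rewrite itv_int_quadratic; field.
apply: eq_itv_int => x _ /=.
rewrite (@eq_itv_int _ _ _ _ (fun y => (u * x + w) ^+ 2 + 2 * v * (u * x + w) * y
  + v ^+ 2 * y ^+ 2)); last by move=> y _; ring.
by rewrite itv_int_quadratic /h; field.
Qed.

(* If the three points lie on a line, the distortion is at least the variance of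
   the projection of the square on the normal to this line. *)
Lemma dist3_collinear a b c (u v w : R) : 0 < u ^+ 2 + v ^+ 2 ->
  u * a.1 + v * a.2 = w -> u * b.1 + v * b.2 = w -> u * c.1 + v * c.2 = w ->
  1 / 12 <= dist3 a b c.
Proof.
move=> N0 aw bw cw; pose r := Num.sqrt (u ^+ 2 + v ^+ 2).
have r2 : r ^+ 2 = u ^+ 2 + v ^+ 2 by rewrite sqr_sqrtr// ltW.
have r0 : 0 < r by rewrite sqrtr_gt0.
have CS z d : u * d.1 + v * d.2 = w ->
    (u / r * z.1 + v / r * z.2 + - w / r) ^+ 2 <= sqdist z d.
  move=> <-; have -> : u / r * z.1 + v / r * z.2 + - (u * d.1 + v * d.2) / r =
      (u * (z.1 - d.1) + v * (z.2 - d.2)) / r by field; rewrite gt_eqF.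
  rewrite expr_div_n ler_pdivrMr ?exprn_gt0// r2 /sqdist.
  have := sqr_ge0 (u * (z.2 - d.2) - v * (z.1 - d.1)); nra.
apply: le_trans (le_sq_int (sq_bounded_sqr (u / r) (v / r) (- w / r))
  (sq_bounded_nearest3 a b c) _); last first.
  by move=> x y _ _; rewrite /nearest3 !le_min !CS.
rewrite sq_int_sqr.
have uv1 : (u / r) ^+ 2 + (v / r) ^+ 2 = 1.
  by rewrite !expr_div_n -mulrDl -r2 divff// expf_neq0// gt_eqF.
(* The integral is 1/12 plus the squared distance from the centre of the square to the line, which
   is a quarter of this square: the projection has variance 1/12 in every direction. *)
have := sqr_ge0 (u / r + v / r + 2 * (- w / r)).
move: (u / r) (v / r) (- w / r) uv1 => p q s; nra.
Qed.

End three_point_distortion.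

(** * Existence of optimal triples *)

Section optimal_triples.
Context {R : realType}.
Implicit Types (a b c z : R * R) (alpha : set (R * R)).

Definition best3 a b c : Prop := forall a' b' c', dist3 a b c <= dist3 a' b' c'.

(** Used with [e = 0] for the projection onto the square, and with a multiple of the distance for
    continuity. *)
Lemma le_dist3 (e : R) a b c a' b' c' : 0 <= e ->
  (forall z, @unit_square R z -> [/\ sqdist z a <= sqdist z a' + e,
    sqdist z b <= sqdist z b' + e & sqdist z c <= sqdist z c' + e]) ->
  dist3 a b c <= dist3 a' b' c' + e.
Proof.
move=> e0 E; have be := sq_bounded_cst e e0.
rewrite /dist3 -{1}(sq_int_cst e) -sq_intD//; last exact: sq_bounded_nearest3.
apply: le_sq_int; [exact: sq_bounded_nearest3| |].
  exact: sq_boundedD (sq_bounded_nearest3 _ _ _) be.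
move=> x y x01 y01; have [|ea eb ec] := E (x, y).
  by split; rewrite /= in_itv.
rewrite /nearest3 -lerBlDr !le_min !lerBlDr !ge_min -andbA.
by rewrite ea eb ec ?orbT.
Qed.

Definition clamp (r : R) : R := Num.min 1 (Num.max 0 r).

Lemma clamp01 r : 0 <= clamp r <= 1.
Proof. by rewrite /clamp le_min ge_min le_max !lexx ler01. Qed.

Lemma sqr_clamp (x r : R) : 0 <= x <= 1 -> (x - clamp r) ^+ 2 <= (x - r) ^+ 2.
Proof.
move=> /andP[x0 x1]; rewrite -subr_ge0.
have [r0|r0] := ltP r 0.
  have -> : clamp r = 0 by rewrite /clamp (max_idPl (ltW r0)); apply/min_idPr.
  have -> : (x - r) ^+ 2 - (x - 0) ^+ 2 = - r * (2 * x - r) by ring.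
  by apply: mulr_ge0; lra.
have [r1|r1] := leP r 1.
  by rewrite /clamp (max_idPr r0) (min_idPr r1) subrr.
have -> : clamp r = 1 by rewrite /clamp (max_idPr r0); apply/min_idPl/ltW.
have -> : (x - r) ^+ 2 - (x - 1) ^+ 2 = (r - 1) * (r + 1 - 2 * x) by ring.
by apply: mulr_ge0; lra.
Qed.

Definition clamp2 a : R * R := (clamp a.1, clamp a.2).

Lemma dist3_clamp a b c : dist3 (clamp2 a) (clamp2 b) (clamp2 c) <= dist3 a b c.
Proof.
rewrite -[leRHS]addr0; apply: le_dist3 => // -[x y] [/=].
rewrite !in_itv /= => x01 y01.
by rewrite !addr0 /sqdist /=; split; apply: lerD; exact: sqr_clamp.
Qed.

(** Each coordinate contributes at most [2 * d], because (u - v)^2 - (u - w)^2 = (v - w)(v + w - 2u)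
    and the second factor is at most 2 in absolute value on the unit interval. *)
Lemma sqdist_close (d : R) z a a' : @unit_square R z -> @unit_square R a ->
  @unit_square R a' -> `|a.1 - a'.1| <= d -> `|a.2 - a'.2| <= d ->
  sqdist z a <= sqdist z a' + 4 * d.
Proof.
case: z a a' => [x y] [a1 a2] [b1 b2] [/=]; rewrite !in_itv /= => x01 y01.
move=> [/=]; rewrite !in_itv /= => a101 a201 [/=]; rewrite !in_itv /= => b101 b201.
have sq (u v w : R) : 0 <= u <= 1 -> 0 <= v <= 1 -> 0 <= w <= 1 -> `|v - w| <= d ->
    (u - v) ^+ 2 <= (u - w) ^+ 2 + 2 * d.
  move=> /andP[u0 u1] /andP[v0 v1] /andP[w0 w1]; rewrite ler_norml => /andP[vw1 vw2].
  have d0 : 0 <= d by lra.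
  have -> : (u - v) ^+ 2 = (u - w) ^+ 2 + (v - w) * (v + w - 2 * u) by ring.
  rewrite lerD2l; have [s0|s0] := leP 0 (v + w - 2 * u).
    apply: (@le_trans _ _ (d * (v + w - 2 * u))); nra.
  apply: (@le_trans _ _ (- d * (v + w - 2 * u))); nra.
move=> d1 d2; rewrite /sqdist /=.
have := sq x a1 b1 x01 a101 b101 d1; have := sq y a2 b2 y01 a201 b201 d2; lra.
Qed.

(** Projection onto the square never increases the distortion, so a minimum over triples in the
    compact square is a global one. *)
Lemma exists_best3 : exists a b c, best3 a b c.
Proof.
pose K := (@unit_square R `*` @unit_square R) `*` @unit_square R.
pose f (u : (R * R) * (R * R) * (R * R)) := dist3 u.1.1 u.1.2 u.2.
have cK : compact K.
  by do !apply: compact_setX; exact: segment_compact.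
have c01 a : @unit_square R (clamp2 a) by split; rewrite /= in_itv /=; exact: clamp01.
have K0 : K !=set0.
  by exists (clamp2 0, clamp2 0, clamp2 0); split; [split|]; exact: c01.
have close u v (d : R) : K u -> K v -> ball u d v -> f u <= f v + 4 * d.
  move=> [[u1 u2] u3] [[v1 v2] v3] [[[b11 b12] [b21 b22]] [b31 b32]].
  have d0 : 0 <= d.
    by apply: ltW; exact: le_lt_trans (normr_ge0 _) b11.
  apply: le_dist3; first by rewrite mulr_ge0.
  by move=> z z01; split; apply: sqdist_close => //; exact: ltW.
have cf : {within K, continuous f}.
  apply/subspace_continuousP => u Ku; apply/cvgrPdist_le => e e0.
  rewrite near_withinE; apply: filterS (nbhsx_ballx u (e / 4) _) => [v uv Kv|].
    have := close u v _ Ku Kv uv; have := close v u _ Kv Ku (ball_sym uv).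
    suff ab (p q : R) : p <= q + 4 * (e / 4) -> q <= p + 4 * (e / 4) -> `|q - p| <= e.
      by move=> uv1 vu1; exact: ab uv1 vu1.
    by move=> pq qp; rewrite ler_norml; apply/andP; split; lra.
  by rewrite divr_gt0.
have [[[a b] c] _ abc] := compact_EVT_min K0 cK cf.
exists a, b, c => a' b' c'; apply: le_trans (dist3_clamp a' b' c').
apply: (abc (clamp2 a', clamp2 b', clamp2 c')); rewrite inE.
by split; [split|]; exact: c01.
Qed.

Lemma distortion_set0 : distortion (unif_square R) set0 = +oo%E.
Proof.
rewrite /distortion; under eq_integral do rewrite image_set0 ereal_inf0.
by rewrite integral_cst//= probability_setT mule1.
Qed.

(** Repetitions among [a], [b], [c] account for the nonempty sets with fewer than three elements. *)
Lemma card_le3P alpha : (alpha #<= `I_3)%card <->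
  alpha = set0 \/ exists a b c, alpha = [set a; b; c].
Proof.
split.
  move=> /pfcard_geP[->|[f]]; [by left|right].
  have I3 (i : nat) : (`I_3 i) <-> [\/ i = 0%N, i = 1%N | i = 2%N].
    by split => [|[->|->|->]]//; case: i => [|[|[|]]]//= _; [constructor 1|constructor 2|constructor 3].
  exists (f 0%N), (f 1%N), (f 2%N); apply/seteqP; split => [x|x].
    move=> /(@surj _ _ _ _ f)[i /I3 i3 <-].
    by case: i3 => ->; [left; left|left; right|right].
  by move=> [[->|->]|->]; apply: funS.
move=> [->|[a [b [c ->]]]]; first exact: card_ge0.
pose f (i : nat) := if i == 0%N then a else if i == 1%N then b else c.
suff <- : f @` `I_3 = [set a; b; c] by exact: card_image_le.
apply/seteqP; split => [x [[|[|[|]]]//= _ <-]|x [[->|->]|->]].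
- by left; left.
- by left; right.
- by right.
- by exists 0%N.
- by exists 1%N.
- by exists 2%N.
Qed.

Lemma quant_error3 a b c : best3 a b c ->
  quant_error 3 (unif_square R) = (dist3 a b c)%:E.
Proof.
move=> abc; apply/le_anti/andP; split.
  rewrite -distortion3; apply: ereal_inf_lbound; exists [set a; b; c] => //.
  by apply/card_le3P; right; exists a, b, c.
apply: le_ereal_inf_tmp => _ [alpha /card_le3P[->|[a' [b' [c' ->]]]] <-].
  by rewrite distortion_set0 leey.
by rewrite distortion3 lee_fin.
Qed.

Lemma optimal_set3P alpha : optimal_set 3 (unif_square R) alpha <->
  exists a b c, alpha = [set a; b; c] /\ best3 a b c.
Proof.
have [a [b [c abc]]] := exists_best3.
rewrite /optimal_set (quant_error3 _ _ _ abc); split.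
  move=> [/card_le3P[->|[a' [b' [c' ->]]]]]; first by rewrite distortion_set0.
  rewrite distortion3 => h; have E : dist3 a' b' c' = dist3 a b c by exact: EFin_inj h.
  exists a', b', c'; split => [//|x y z].
  by rewrite E; exact: abc.
move=> [a' [b' [c' [-> abc']]]]; split; first by apply/card_le3P; right; exists a', b', c'.
have E : dist3 a' b' c' = dist3 a b c by apply/le_anti/andP; split; [exact: abc'|exact: abc].
by rewrite distortion3 E.
Qed.

End optimal_triples.

(** * The gain function *)

Section reduced_gain.
Context {R : realFieldType}.
Implicit Types (w d N s t b : R).

(* [w] and [d] are the sum and the difference of the heights at which an affine
   threshold meets the sides x_1 = 0, 1 and the axis x_1 = 1/2. *)
Definition gain w d : R := 72 + 45 * w - 18 * w ^+ 2 + 6 * d - 12 * d ^+ 2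
  + d ^+ 2 / w + 2 * d ^+ 4 / (w * (2 - w)).

(* The distortion of (1/2, b), (1/2 - s, t), (1/2 + s, t) when the first cell is
   the part of the square above a threshold with these moments. *)
Definition cost w d N s t b : R := 5 / 12 + w / 2 * s ^+ 2 - s * (3 * w + d) / 12
  + w / 2 * t ^+ 2 - t * N / 12 - b * (1 - N / 12) + b ^+ 2 * (1 - w / 2).

(** Squares are completed at the centroids of the cells. The last term is what remains of [N]: for
    the moments of a threshold, 0 <= 6w - N <= 3w(2 - w) - d^2, so it is nonnegative, and it
    vanishes only for N = 3w^2 + d^2. *)
Lemma cost_decomposition w d N s t b : 0 < w -> w < 2 ->
  cost w d N s t b = 5 / 12 - gain w d / 288
    + w / 2 * (s - (3 * w + d) / (12 * w)) ^+ 2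
    + w / 2 * (t - N / (12 * w)) ^+ 2
    + (1 - w / 2) * (b - (12 - N) / (12 * (2 - w))) ^+ 2
    + ((3 * w * (2 - w) - d ^+ 2) ^+ 2 - (6 * w - N) ^+ 2) / (144 * (w * (2 - w))).
Proof.
move=> w0 w2; have w0' : w != 0 by rewrite gt_eqF.
have w2' : 2 - w != 0 by rewrite gt_eqF// subr_gt0.
by rewrite /cost /gain; field; rewrite ?w0' ?w2'.
Qed.

(** The cutoff 100.94 is just below 288 (5/12 - 0.06618), the gain forced by the upper bound 0.06618
    for the optimal distortion. *)
Lemma gain_box w d : 0 < w -> w < 2 -> d ^+ 2 <= 3 * w * (2 - w) ->
  100 + 94 / 100 <= gain w d -> [/\ 1 <= w, w <= 3 / 2, 0 <= d & d <= 1 / 2].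
Proof.
move=> w0 w2 dz; rewrite /gain.
have z0 : 0 < w * (2 - w) by rewrite mulr_gt0// subr_gt0.
have [A EA] : exists A, A = d ^+ 2 / w by exists (d ^+ 2 / w).
have [B EB] : exists B, B = 2 * d ^+ 4 / (w * (2 - w)) by eexists.
rewrite -EA -EB => h; have d20 := sqr_ge0 d; have d40 := sqr_ge0 (d ^+ 2).
have E4 : d ^+ 4 = (d ^+ 2) ^+ 2 by rewrite -exprM.
rewrite E4 in EB.
(* One factor d^2 is traded for the constraint, which bounds the quartic term by a quadratic one
   even near w = 0 and w = 2. *)
have q3 : B <= 6 * d ^+ 2.
  rewrite EB ler_pdivrMr//.
  by have := mulr_ge0 d20 (_ : 0 <= 3 * w * (2 - w) - d ^+ 2); rewrite subr_ge0 => /(_ dz); nra.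
have A0 k : d ^+ 2 <= k * w -> A <= k by rewrite EA ler_pdivrMr.
(* Sharper for small [d]; 3/4 is the minimum of w(2 - w) for w between 1 and 3/2. *)
have q4 : 3 / 4 <= w * (2 - w) -> B <= 8 / 3 * (d ^+ 2) ^+ 2.
  move=> z34; rewrite EB ler_pdivrMr//.
  by move: ((d ^+ 2) ^+ 2) (w * (2 - w)) d40 z34 => x y; clear; nra.
clear EA EB E4.
have w1 : 1 <= w.
  rewrite leNgt; apply/negP => w1.
  have [wh|wh] := ltP w (1 / 2).
    have : A <= 6 by apply: A0; have := sqr_ge0 w; lra.
    have := sqr_ge0 (d - 1 / 2); nra.
  have [w9|w9] := ltP w (9 / 10).
    have : A <= 2 * d ^+ 2 by apply: A0; nra.
    have := sqr_ge0 (d - 3 / 4); nra.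
  have : A <= 10 / 9 * d ^+ 2 by apply: A0; nra.
  have := sqr_ge0 (d - 27 / 44); nra.
have wd : A <= d ^+ 2 by apply: A0; nra.
have w54 := sqr_ge0 (w - 5 / 4).
have w3 : w <= 3 / 2.
  rewrite leNgt; apply/negP => w3.
  have := sqr_ge0 (d - 3 / 5); nra.
have d0 : 0 <= d by rewrite leNgt; apply/negP => d0; nra.
split=> //; rewrite leNgt; apply/negP => d1.
have [d2|d2] := ltP (11 / 10) d; first by nra.
have {}q4 : B <= 8 / 3 * (d ^+ 2) ^+ 2 by apply: q4; nra.
have q k : d ^+ 2 <= k -> (d ^+ 2) ^+ 2 <= k * d ^+ 2 by move=> dk; rewrite expr2 ler_wpM2r.
have [d3|d3] := ltP d (3 / 5).
  have := q (36 / 100) _; nra.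
have := q (121 / 100) _; nra.
Qed.

(** The partial derivatives of [gain], entered as formulas: the expansion in [gain_tangent] is an
    algebraic identity and needs no calculus. *)
Definition gain_dw w d : R :=
  45 - 36 * w - d ^+ 2 / w ^+ 2 - 2 * d ^+ 4 * (2 - 2 * w) / (w * (2 - w)) ^+ 2.

Definition gain_dd w d : R := 6 - 24 * d + 2 * d / w + 8 * d ^+ 3 / (w * (2 - w)).

(** The convex function u^2/v has the exact remainder (u - (u1/v1) v)^2 / v at (u1, v1). Taking (u,
    v) = (d, w) and (d^2, w(2 - w)) gives the two quotients of the identity; the terms in [rho]
    outside them come from the curvature of d^2 and w(2 - w). On the box all of them are outweighed
    by the squares with coefficients 18 and 12. *)
Lemma gain_tangent w d w1 d1 : 1 <= w <= 3 / 2 -> 0 <= d <= 1 / 2 ->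
  1 <= w1 <= 3 / 2 -> 0 <= d1 <= 1 / 2 ->
  gain w d <= gain w1 d1 + gain_dw w1 d1 * (w - w1) + gain_dd w1 d1 * (d - d1)
    - ((w - w1) ^+ 2 + (d - d1) ^+ 2).
Proof.
move=> /andP[wa wb] /andP[da db] /andP[w1a w1b] /andP[d1a d1b].
pose z := w * (2 - w); pose z1 := w1 * (2 - w1).
have z34 : 3 / 4 <= z by rewrite /z; nra.
have z134 : 3 / 4 <= z1 by rewrite /z1; nra.
pose rho := d1 ^+ 2 / z1; pose r := d1 / w1.
have w0 : w != 0 by rewrite gt_eqF//; lra.
have w10 : w1 != 0 by rewrite gt_eqF//; lra.
have w20 : 2 - w != 0 by rewrite gt_eqF//; lra.
have w120 : 2 - w1 != 0 by rewrite gt_eqF//; lra.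
have -> : gain w d = gain w1 d1 + gain_dw w1 d1 * (w - w1) + gain_dd w1 d1 * (d - d1)
    - 18 * (w - w1) ^+ 2 - 12 * (d - d1) ^+ 2
    + ((d - d1) - r * (w - w1)) ^+ 2 / w
    + 2 * (((d + d1) * (d - d1) - rho * (2 - w - w1) * (w - w1)) ^+ 2 / z
      + 2 * (rho * (d - d1) ^+ 2) + rho ^+ 2 * (w - w1) ^+ 2).
  by rewrite /gain /gain_dw /gain_dd /rho /r /z /z1; field; rewrite ?w0 ?w10 ?w20 ?w120.
have r0 : 0 <= r <= 1 / 2.
  by rewrite /r divr_ge0 ?ler_pdivrMr//=; nra.
have rho0 : 0 <= rho <= 1 / 3.
  by rewrite /rho divr_ge0 ?sqr_ge0 ?ler_pdivrMr//=; nra.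
have T1 : (d - d1 - r * (w - w1)) ^+ 2 / w <= 2 * (d - d1) ^+ 2 + (w - w1) ^+ 2 / 2.
  have wgt0 : 0 < w by lra.
  move: (d - d1) (w - w1) => x y; rewrite ler_pdivrMr//.
  apply: (@le_trans _ _ ((2 * x ^+ 2 + y ^+ 2 / 2) * 1)); last first.
    by rewrite ler_wpM2l//; have := sqr_ge0 x; have := sqr_ge0 y; lra.
  have r2 : r ^+ 2 * y ^+ 2 <= y ^+ 2 / 4.
    rewrite [leRHS]mulrC ler_wpM2r ?sqr_ge0//; clear -r0; case/andP: r0; nra.
  have := sqr_ge0 (x + r * y); clear -r2; nra.
have T2 : ((d + d1) * (d - d1) - rho * (2 - w - w1) * (w - w1)) ^+ 2 / z <=
    8 / 3 * ((d - d1) ^+ 2 + (w - w1) ^+ 2 / 9).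
  have k1 : 0 <= d + d1 <= 1 by lra.
  have l1 : (rho * (2 - w - w1)) ^+ 2 <= 1 / 9.
    have : (2 - w - w1) ^+ 2 <= 1 by clear -wa wb w1a w1b; nra.
    move: (2 - w - w1) => m m1; rewrite exprMn.
    have : rho ^+ 2 <= 1 / 9 by clear -rho0; case/andP: rho0; nra.
    have := sqr_ge0 rho; have := sqr_ge0 m; clear -m1; nra.
  move: (d + d1) (rho * (2 - w - w1)) (d - d1) (w - w1) k1 l1 => k l x y /andP[k0 k1] l1.
  rewrite ler_pdivrMr; last by lra.
  have kx : (k * x) ^+ 2 <= x ^+ 2 by rewrite exprMn ler_piMl ?sqr_ge0//; clear -k0 k1; nra.
  have ly : (l * y) ^+ 2 <= 1 / 9 * y ^+ 2 by rewrite exprMn ler_wpM2r ?sqr_ge0.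
  apply: (@le_trans _ _ (8 / 3 * (x ^+ 2 + y ^+ 2 / 9) * (3 / 4))); last first.
    by rewrite ler_wpM2l//; have := sqr_ge0 x; have := sqr_ge0 y; lra.
  have := sqr_ge0 (k * x + l * y); clear -kx ly; nra.
have T3 : rho * (d - d1) ^+ 2 <= (d - d1) ^+ 2 / 3.
  by rewrite [leRHS]mulrC ler_wpM2r ?sqr_ge0//; case/andP: rho0; lra.
have T4 : rho ^+ 2 * (w - w1) ^+ 2 <= (w - w1) ^+ 2 / 9.
  by rewrite [leRHS]mulrC ler_wpM2r ?sqr_ge0//; clear -rho0; case/andP: rho0; nra.
move: T1 T2 T3 T4 (sqr_ge0 (w - w1)) (sqr_ge0 (d - d1)).
move: (_ ^+ 2 / w) (_ ^+ 2 / z) (rho * _ ^+ 2) (rho ^+ 2 * _) => A B C D.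
move: (gain w1 d1) (gain_dw w1 d1 * _) (gain_dd w1 d1 * _) => g gw gd.
move: ((w - w1) ^+ 2) ((d - d1) ^+ 2) => x y; clear; lra.
Qed.

Definition in_box w d : Prop := 1 <= w <= 3 / 2 /\ 0 <= d <= 1 / 2.

Definition box_max w d : Prop :=
  in_box w d /\ forall w' d', in_box w' d' -> gain w' d' <= gain w d.

(** With the midpoint of the two maxima as tangent point, the linear terms cancel and only the
    negative squares remain. *)
Lemma box_max_unique w d w' d' : box_max w d -> box_max w' d' -> w = w' /\ d = d'.
Proof.
move=> [[wb db] m] [[wb' db'] m'].
have [mw md] : in_box ((w + w') / 2) ((d + d') / 2) by split; lra.
have := gain_tangent _ _ _ _ wb db mw md; have := gain_tangent _ _ _ _ wb' db' mw md.
have := m _ _ (conj mw md); have := m' _ _ (conj mw md).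
have -> : w - (w + w') / 2 = (w - w') / 2 by field.
have -> : d - (d + d') / 2 = (d - d') / 2 by field.
have -> : w' - (w + w') / 2 = - ((w - w') / 2) by field.
have -> : d' - (d + d') / 2 = - ((d - d') / 2) by field.
move: (gain w d) (gain w' d') (gain _ _) (gain_dw _ _) (gain_dd _ _) => g g' gm gw gd.
rewrite !mulrN !sqrrN => g1 g2 g3 g4.
have sq0 : ((w - w') / 2) ^+ 2 + ((d - d') / 2) ^+ 2 <= 0 by lra.
have x0 := sqr_ge0 ((w - w') / 2); have y0 := sqr_ge0 ((d - d') / 2).
have /eqP : ((w - w') / 2) ^+ 2 = 0 by apply/eqP; rewrite eq_le x0 andbT; lra.
have /eqP : ((d - d') / 2) ^+ 2 = 0 by apply/eqP; rewrite eq_le y0 andbT; lra.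
rewrite !sqrf_eq0 => /eqP dd /eqP ww; split; lra.
Qed.

(** Numerical critical point of [gain], (1.24882647, 0.27586860), written in base 100 so that only
    small numerals occur. *)
Definition w_approx : R := 1 + (24 + (88 + (26 + 47 / 100) / 100) / 100) / 100.
Definition d_approx : R := (27 + (58 + (68 + 60 / 100) / 100) / 100) / 100.

Lemma approx_in_box : in_box w_approx d_approx.
Proof. by rewrite /in_box /w_approx /d_approx; split; lra. Qed.

Lemma norm_frac_le (x y e : R) : 0 < y -> - (e * y) <= x <= e * y -> `|x / y| <= e.
Proof.
by move=> y0; rewrite ler_norml ler_pdivlMr// ler_pdivrMr// mulNr.
Qed.

Let w0 : w_approx != 0. Proof. by apply: lt0r_neq0; rewrite /w_approx; lra. Qed.
Let w20 : 2 - w_approx != 0. Proof. by apply: lt0r_neq0; rewrite /w_approx; lra. Qed.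

Lemma gain_dw_approx : `|gain_dw w_approx d_approx| <= 2 / 100 / 100 / 100 / 10.
Proof.
pose w := w_approx; pose d := d_approx.
have -> : gain_dw w_approx d_approx =
    ((45 - 36 * w) * (w * (2 - w)) ^+ 2 - d ^+ 2 * (2 - w) ^+ 2
      - 2 * d ^+ 4 * (2 - 2 * w)) / (w * (2 - w)) ^+ 2.
  by rewrite /gain_dw /w /d; field; rewrite w0 w20.
apply: norm_frac_le; rewrite /w /d /w_approx /d_approx; first by lra.
by apply/andP; split; lra.
Qed.

Lemma gain_dd_approx : `|gain_dd w_approx d_approx| <= 2 / 100 / 100 / 100 / 10.
Proof.
pose w := w_approx; pose d := d_approx.
have -> : gain_dd w_approx d_approx =
    ((6 - 24 * d) * (w * (2 - w)) + 2 * d * (2 - w) + 8 * d ^+ 3) / (w * (2 - w)).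
  by rewrite /gain_dd /w /d; field; rewrite w0 w20.
apply: norm_frac_le; rewrite /w /d /w_approx /d_approx; first by lra.
by apply/andP; split; lra.
Qed.

Lemma gain_approx : `|5 / 12 - gain w_approx d_approx / 288
  - (6 + (61 + (79 + 70 / 100) / 100) / 100) / 100| <= 6 / 100 / 100 / 100 / 100.
Proof.
pose w := w_approx; pose d := d_approx.
have -> : 5 / 12 - gain w_approx d_approx / 288
    - (6 + (61 + (79 + 70 / 100) / 100) / 100) / 100 =
    ((5 / 12 - (6 + (61 + (79 + 70 / 100) / 100) / 100) / 100
      - (72 + 45 * w - 18 * w ^+ 2 + 6 * d - 12 * d ^+ 2) / 288) * (w * (2 - w))
      - (d ^+ 2 * (2 - w) + 2 * d ^+ 4) / 288) / (w * (2 - w)).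
  by rewrite /gain /w /d; field; rewrite w0 w20.
apply: norm_frac_le; rewrite /w /d /w_approx /d_approx; first by lra.
by apply/andP; split; lra.
Qed.

(** The gradient at the rational point is at most e = 2/10^7 in each coordinate, so strong concavity
    leaves only displacements with x^2 + y^2 <= e(|x| + |y|). *)
Lemma box_max_approx w d : box_max w d -> [/\ `|w - w_approx| <= 5 / 100 / 100 / 100 / 10,
  `|d - d_approx| <= 5 / 100 / 100 / 100 / 10 &
  gain w_approx d_approx <= gain w d <= gain w_approx d_approx + 1 / 100 / 100 / 100 / 10].
Proof.
move=> [[wb db] m]; have [ab1 ab2] := approx_in_box.
have g0 := m _ _ approx_in_box.
have := gain_tangent _ _ _ _ wb db ab1 ab2.
have := gain_dw_approx; have := gain_dd_approx.
move: (gain_dw _ _) (gain_dd _ _) (gain w d) (gain w_approx d_approx) g0.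
clear m wb db ab1 ab2.
move: (w - w_approx) (d - d_approx) => x y gw gd g ga g0 hgw hgd gt.
pose e : R := 2 / 100 / 100 / 100 / 10; have e0 : 0 < e by rewrite /e; lra.
have hx : gw * x <= e * `|x|.
  by rewrite (le_trans (ler_norm _))// normrM ler_wpM2r.
have hy : gd * y <= e * `|y|.
  by rewrite (le_trans (ler_norm _))// normrM ler_wpM2r.
have : `|x| ^+ 2 + `|y| ^+ 2 <= e * `|x| + e * `|y|.
  rewrite !real_normK ?num_real//; lra.
have {}gt : g <= ga + e * `|x| + e * `|y|.
  by have := sqr_ge0 x; have := sqr_ge0 y; lra.
move: (`|x|) (`|y|) (normr_ge0 x) (normr_ge0 y) gt => p q p0 q0 gt pq; clear -e0 p0 q0 gt pq g0.
(* The inequality reads (p - e/2)^2 + (q - e/2)^2 <= e^2/2, so [p] and [q] are below 2e. *)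
have sp := sqr_ge0 (p - e / 2); have sq := sqr_ge0 (q - e / 2).
have pe : p <= 2 * e by rewrite leNgt; apply/negP => ep; nra.
have qe : q <= 2 * e by rewrite leNgt; apply/negP => ep; nra.
have [pe1 qe1] : p <= 5 / 100 / 100 / 100 / 10 /\ q <= 5 / 100 / 100 / 100 / 10 by rewrite /e in pe qe; lra.
split=> //; rewrite g0 /=; rewrite /e in gt; lra.
Qed.

Lemma box_max_coordinates w d : box_max w d -> let N := 3 * w ^+ 2 + d ^+ 2 in
  [/\ `|1 / 2 - (3 * w + d) / (12 * w) - (23 + (15 + 91 / 100) / 100) / 100| < 1 / 100 / 100 / 100,
      `|N / (12 * w) - (31 + (72 + 85 / 100) / 100) / 100| < 1 / 100 / 100 / 100 &
      `|(12 - N) / (12 * (2 - w)) - (80 + (37 + 64 / 100) / 100) / 100| < 1 / 100 / 100 / 100].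
Proof.
have norm_frac_lt (x y e : R) : 0 < y -> - (e * y) < x < e * y -> `|x / y| < e.
  by move=> y0; rewrite ltr_norml ltr_pdivlMr// ltr_pdivrMr// mulNr.
move=> wd N; have [+ + _] := box_max_approx _ _ wd.
have [/andP[w1 w2] _] := wd.1.
have wn0 : w != 0 by rewrite gt_eqF//; lra.
have w2n0 : 2 - w != 0 by rewrite gt_eqF//; lra.
have E1 c : 1 / 2 - (3 * w + d) / (12 * w) - c = ((1 / 4 - c) * (12 * w) - d) / (12 * w).
  by field; rewrite wn0.
have E2 c : N / (12 * w) - c = (N - c * (12 * w)) / (12 * w) by field; rewrite wn0.
have E3 c : (12 - N) / (12 * (2 - w)) - c =
    (12 - N - c * (12 * (2 - w))) / (12 * (2 - w)) by field; rewrite w2n0.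
rewrite E1 E2 E3 /N; clear N E1 E2 E3 wn0 w2n0 wd.
move: (w - w_approx) (d - d_approx) (subrK w_approx w) (subrK d_approx d) => x y Ew Ed.
rewrite !ler_norml => /andP[x1 x2] /andP[y1 y2].
(* The squares of the errors are bounded separately and then treated as variables, which leaves
   linear inequalities. *)
have x20 : 0 <= x ^+ 2 <= 1 / 100 / 100 / 100 / 100 / 10 by rewrite sqr_ge0 /=; clear -x1 x2; nra.
have y20 : 0 <= y ^+ 2 <= 1 / 100 / 100 / 100 / 100 / 10 by rewrite sqr_ge0 /=; clear -y1 y2; nra.
move: x20 y20 => /andP[x20 x21] /andP[y20 y21].
have Ew2 : w ^+ 2 = x ^+ 2 + 2 * x * w_approx + w_approx ^+ 2 by rewrite -Ew; ring.
have Ed2 : d ^+ 2 = y ^+ 2 + 2 * y * d_approx + d_approx ^+ 2 by rewrite -Ed; ring.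
rewrite Ew2 Ed2 -{}Ew -{}Ed {w d w1 w2 Ew2 Ed2}.
move: (x ^+ 2) (y ^+ 2) x20 x21 y20 y21 => x' y' x20 x21 y20 y21.
rewrite /w_approx /d_approx.
split; apply: norm_frac_lt; try (apply/andP; split).
all: try (clear x20 x21 y20 y21; lra).
all: lra.
Qed.

End reduced_gain.

(** * Symmetry with respect to the line x_1 = 1/2 *)

Section axis_symmetric.
Context {R : realType}.
Notation mu := (@lebesgue_measure R).
Implicit Types (s t b w d x y : R) (c : R -> R).

Notation off x := `|x - 1 / 2|.

Lemma norm_pos_part x : `|x| = 2 * pos_part x - x.
Proof.
have [x0|/ltW x0] := leP 0 x; first by rewrite ger0_norm// pos_part_ge0//; lra.
by rewrite ler0_norm// pos_part_le0//; lra.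
Qed.

Lemma off_ge0_le1 x : 0 <= x <= 1 -> 0 <= off x <= 1 / 2.
Proof. by move=> /andP[x0 x1]; rewrite normr_ge0 ler_norml; apply/andP; split; lra. Qed.

Lemma continuous_off : continuous (fun x => off x : R).
Proof.
move=> x; apply: (@continuous_comp _ _ _ (fun z : R => z - 1 / 2) Num.norm).
  by apply: cvgB; [exact: cvg_id|exact: cvg_cst].
exact: norm_continuous.
Qed.

Lemma itv_int_off : itv_int 0 1 (fun x => off x) = 1 / 4.
Proof.
have P01 : itv_int 0 1 (fun x => pos_part (- (1 / 2) + 1 * x) ^+ 1) = 1 / 8 :> R.
  rewrite itv_int_pos_affine_pow ?oner_neq0// (pos_part_le0 (_ + 1 * 0)); last by lra.
  by rewrite pos_part_ge0; [field|lra].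
have E : itv_int 0 1 (fun x => off x) =
    itv_int 0 1 (fun x => 2 * pos_part (- (1 / 2) + 1 * x) ^+ 1 + (1 / 2 + (- 1) * x)).
  by apply: eq_itv_int => x _; rewrite norm_pos_part (_ : - (1 / 2) + 1 * x = x - 1 / 2); [rewrite expr1; ring|ring].
have ci : mu.-integrable `[0, 1] (EFin \o (fun x => pos_part (- (1 / 2) + 1 * x) ^+ 1 : R)).
  exact/continuous_integrable_itv/continuous_pow/continuous_pos_part/affine_continuous.
rewrite E itv_intD; last 2 first.
- apply: continuous_integrable_itv => x; apply: cvgM; first exact: cvg_cst.
  exact: (continuous_pow _ 1 (continuous_pos_part _ (affine_continuous _ _))).
- exact/continuous_integrable_itv/affine_continuous.
rewrite itv_intZ// P01.
rewrite (@eq_itv_int _ _ _ _ (fun x => 1 / 2 + (- 1) * x + 0 * x ^+ 2)).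
  by rewrite itv_int_quadratic; field.
by move=> x _; rewrite mul0r addr0.
Qed.

Lemma itv_int_off_sqr : itv_int 0 1 (fun x => off x ^+ 2) = 1 / 12.
Proof.
rewrite (@eq_itv_int _ _ _ _ (fun x => 1 / 4 + (- 1) * x + 1 * x ^+ 2)).
  by rewrite itv_int_quadratic; field.
by move=> x _; rewrite real_normK ?num_real//; field.
Qed.

(** The height function of an arbitrary division of the square into a lower and an upper cell; it is
    not tied to a bisector. *)
Definition threshold c : Prop :=
  measurable_fun (setT : set (measurableTypeR R)) c /\
  forall x, 0 <= x <= 1 -> 0 <= c x <= 1.

Lemma moments c (u0 u1 u2 u3 u4 u5 : R) : threshold c ->
  let f x := u0 + u1 * off x + u2 * off x ^+ 2 + u3 * c x + u4 * (off x * c x) + u5 * c x ^+ 2 in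
  mu.-integrable `[0, 1] (EFin \o f) /\
  itv_int 0 1 f = u0 + u1 / 4 + u2 / 12 + u3 * itv_int 0 1 c
    + u4 * itv_int 0 1 (fun x => off x * c x) + u5 * itv_int 0 1 (fun x => c x ^+ 2).
Proof.
move=> [mc c01] f.
have i0 : mu.-integrable `[0, 1] (EFin \o (fun=> u0)).
  by apply: continuous_integrable_itv; exact: cst_continuous.
have iX : mu.-integrable `[0, 1] (EFin \o (fun x => off x : R)).
  exact/continuous_integrable_itv/continuous_off.
have iX2 : mu.-integrable `[0, 1] (EFin \o (fun x => off x ^+ 2 : R)).
  exact/continuous_integrable_itv/continuous_pow/continuous_off.
have moff : measurable_fun (setT : set (measurableTypeR R)) (fun x => off x : R).
  exact: continuous_measurable_fun continuous_off.
have ic : mu.-integrable `[0, 1] (EFin \o c).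
  apply: (bounded_integrable_itv _ 1); first exact: measurable_funTS.
  by move=> x /c01 /andP[c0 c1]; rewrite ger0_norm.
have iXc : mu.-integrable `[0, 1] (EFin \o (fun x => off x * c x)).
  apply: (bounded_integrable_itv _ 1); first by apply: measurable_funTS; exact: measurable_funM.
  move=> x x01; have /andP[c0 c1] := c01 x x01; have /andP[of0 of1] := off_ge0_le1 x x01.
  by rewrite ger0_norm ?mulr_ge0//; nra.
have ic2 : mu.-integrable `[0, 1] (EFin \o (fun x => c x ^+ 2)).
  apply: (bounded_integrable_itv _ 1); first by apply: measurable_funTS; exact: measurable_funX.
  by move=> x /c01 /andP[c0 c1]; rewrite ger0_norm ?sqr_ge0//; nra.
have iZ (h : R -> R) k : mu.-integrable `[0, 1] (EFin \o h) ->
    mu.-integrable `[0, 1] (EFin \o (fun x => k * h x)).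
  move=> ih; have -> : EFin \o (fun x => k * h x) = (fun x => k%:E * (EFin \o h) x)%E.
    by apply/funext.
  exact: integrableZl.
have iD (g h : R -> R) : mu.-integrable `[0, 1] (EFin \o g) ->
    mu.-integrable `[0, 1] (EFin \o h) ->
    mu.-integrable `[0, 1] (EFin \o (fun x => g x + h x)).
  move=> ig ih; have -> : EFin \o (fun x => g x + h x) = ((EFin \o g) \+ (EFin \o h))%E.
    by apply/funext => x.
  exact: integrableD.
have i1 := iD _ _ i0 (iZ _ u1 iX).
have i2 := iD _ _ i1 (iZ _ u2 iX2).
have i3 := iD _ _ i2 (iZ _ u3 ic).
have i4 := iD _ _ i3 (iZ _ u4 iXc).
have i5 := iD _ _ i4 (iZ _ u5 ic2).
split; first exact: i5.
rewrite /f (itv_intD _ _ _ _ i4 (iZ _ u5 ic2)) (itv_intD _ _ _ _ i3 (iZ _ u4 iXc)).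
rewrite (itv_intD _ _ _ _ i2 (iZ _ u3 ic)) (itv_intD _ _ _ _ i1 (iZ _ u2 iX2)).
rewrite (itv_intD _ _ _ _ i0 (iZ _ u1 iX)) !itv_intZ//.
by rewrite itv_int_cst// itv_int_off itv_int_off_sqr; field.
Qed.

(** The normalization makes an affine threshold return its own parameters [w] and [d]. *)
Definition width c : R := 2 * itv_int 0 1 c.
Definition slope c : R :=
  24 * itv_int 0 1 (fun x => off x * c x) - 6 * itv_int 0 1 c.
Definition second_moment c : R := 12 * itv_int 0 1 (fun x => c x ^+ 2).

(* The second bound is the Cauchy-Schwarz inequality for [c] and [off], i.e. the
   nonnegativity of the residual variance of [c] after regression on [off]. *)
Lemma threshold_bounds c : threshold c ->
  [/\ 0 <= width c <= 2, slope c ^+ 2 <= second_moment c - 3 * width c ^+ 2 &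
      second_moment c <= 6 * width c].
Proof.
move=> tc; have mom u0 u1 u2 u3 u4 u5 := (moments c u0 u1 u2 u3 u4 u5 tc).2.
have ge0 (f : R -> R) : (forall x, 0 <= x <= 1 -> 0 <= f x) -> 0 <= itv_int 0 1 f.
  by move=> f0; apply: Rintegral_ge0 => x /=; rewrite in_itv /=; exact: f0.
rewrite /width /slope /second_moment.
move: (itv_int 0 1 c) (itv_int 0 1 (fun x => off x * c x))
  (itv_int 0 1 (fun x => c x ^+ 2)) mom => m mX m2 mom.
have h1 : 0 <= m.
  have := mom 0 0 0 1 0 0; rewrite !(mul0r, mul1r, add0r, addr0) => <-.
  by apply: ge0 => x /tc.2 /andP[c0 c1]; rewrite !(mul0r, mul1r, add0r, addr0).
have h2 : m <= 1.
  have := mom 1 0 0 (-1) 0 0; rewrite !(mul0r, mulN1r, add0r, addr0) => E.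
  rewrite -subr_ge0 -E.
  by apply: ge0 => x /tc.2 /andP[c0 c1]; rewrite !(mul0r, mulN1r, add0r, addr0) subr_ge0.
have h3 : m2 <= m.
  have := mom 0 0 0 1 0 (-1); rewrite !(mul0r, mul1r, mulN1r, add0r, addr0) => E.
  rewrite -subr_ge0 -E.
  apply: ge0 => x /tc.2 /andP[c0 c1]; rewrite !(mul0r, mul1r, mulN1r, add0r, addr0).
  by nra.
(* Least squares fit of [c] by [A + B * off]: [off] has mean 1/4 and variance 1/48. *)
pose B := 48 * mX - 12 * m; pose A := m - B / 4.
have h4 : 0 <= A ^+ 2 + 2 * A * B / 4 + B ^+ 2 / 12 - 2 * A * m - 2 * B * mX + m2.
  have -> : A ^+ 2 + 2 * A * B / 4 + B ^+ 2 / 12 - 2 * A * m - 2 * B * mX + m2 =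
     A ^+ 2 + (2 * A * B) / 4 + B ^+ 2 / 12 + (- (2 * A)) * m + (- (2 * B)) * mX + 1 * m2.
    by ring.
  rewrite -mom; apply: ge0 => x _.
  by have := sqr_ge0 (c x - A - B * off x); congr (_ <= _); ring.
rewrite /A /B in h4.
by split; [apply/andP; split|..]; lra.
Qed.

(** Folding along the axis merges the mirror points into one at offset [s]; in a fixed column its
    advantage over the axis point is affine in [y]. *)
Lemma nearest3_axis b s t x y : 0 <= s ->
  nearest3 (1 / 2, b) (1 / 2 - s, t) (1 / 2 + s, t) (x, y) =
  off x ^+ 2 + (y - b) ^+ 2 -
  pos_part ((2 * s * off x - s ^+ 2 + b ^+ 2 - t ^+ 2) + (- (2 * (b - t))) * y).
Proof.
move=> s0; rewrite /nearest3 /sqdist /=.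
have offE : (x - 1 / 2) ^+ 2 = off x ^+ 2 by rewrite real_normK ?num_real.
have minpos (u v : R) : Num.min u v = u - pos_part (u - v).
  have [uv|/ltW uv] := leP u v; first by rewrite pos_part_le0 ?subr0//; lra.
  by rewrite pos_part_ge0; lra.
have -> : forall u v z : R, Num.min (Num.min u v) z = Num.min u (Num.min v z).
  by move=> u v z; rewrite minA.
have -> : Num.min ((x - (1 / 2 - s)) ^+ 2 + (y - t) ^+ 2)
    ((x - (1 / 2 + s)) ^+ 2 + (y - t) ^+ 2) = (off x - s) ^+ 2 + (y - t) ^+ 2.
  have [x0|/ltW x0] := leP 0 (x - 1 / 2).
    by rewrite ger0_norm//; apply/eqP; rewrite eq_le le_min ge_min; apply/and3P; split; nra.
  by rewrite ler0_norm//; apply/eqP; rewrite eq_le le_min ge_min; apply/and3P; split; nra.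
by rewrite minpos offE; congr (_ - pos_part _); ring.
Qed.

(** The left side is the integral of A - k y over [0, r], the right side that of its positive part
    over [0, 1]. This is why every threshold gives an upper bound. *)
Lemma le_pos_part_gain (A k r : R) : 0 < k -> 0 <= r <= 1 ->
  r * A - k * r ^+ 2 / 2 <= (pos_part A ^+ 2 - pos_part (A - k) ^+ 2) / (2 * k).
Proof.
move=> k0 /andP[r0 r1]; rewrite ler_pdivlMr; last by lra.
have [A0|A0] := leP A 0.
  rewrite (pos_part_le0 A)// pos_part_le0; last by lra.
  have NA0 : 0 <= - A by lra.
  have := mulr_ge0 (mulr_ge0 (ltW k0) r0) NA0; have := sqr_ge0 (k * r); lra.
have [Ak|Ak] := leP A k.
  rewrite (pos_part_ge0 A (ltW A0)) pos_part_le0; last by lra.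
  have := sqr_ge0 (A - k * r); lra.
rewrite (pos_part_ge0 A (ltW A0)) pos_part_ge0; last by lra.
have -> : A ^+ 2 - (A - k) ^+ 2 = (A - k / 2) * (2 * k) by field.
rewrite ler_pM2r; last by lra.
have : 0 <= (1 - r) * (A - k * (1 + r) / 2) by apply: mulr_ge0; nra.
lra.
Qed.

(** Equality case: A - k y changes sign at A / k, so the integral stopped there collects exactly the
    positive part. *)
Lemma pos_part_gain (A k : R) : 0 < k -> let r := clamp (A / k) in
  r * A - k * r ^+ 2 / 2 = (pos_part A ^+ 2 - pos_part (A - k) ^+ 2) / (2 * k).
Proof.
move=> k0; have kn0 : k != 0 by rewrite gt_eqF.
have [A0|A0] := leP A 0.
  rewrite (pos_part_le0 A)// pos_part_le0; last by lra.
  have -> : clamp (A / k) = 0.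
    rewrite /clamp max_l; last by rewrite pmulr_lle0// invr_gt0.
    by rewrite min_r.
  by field.
have [Ak|Ak] := leP A k.
  rewrite (pos_part_ge0 A (ltW A0)) pos_part_le0; last by lra.
  have -> : clamp (A / k) = A / k.
    rewrite /clamp max_r; last by rewrite divr_ge0 ?ltW.
    by rewrite min_r// ler_pdivrMr// mul1r.
  by field.
rewrite (pos_part_ge0 A (ltW A0)) pos_part_ge0; last by lra.
have -> : clamp (A / k) = 1.
  rewrite /clamp max_r; last by rewrite divr_ge0 ?ltW.
  by rewrite min_l// ler_pdivlMr// mul1r ltW.
by field.
Qed.

Definition axis_dist3 b s t : R := dist3 (1 / 2, b) (1 / 2 - s, t) (1 / 2 + s, t).

Lemma slice_axis b s t x : 0 <= s -> t < b ->
  let A := 2 * s * off x - s ^+ 2 + b ^+ 2 - t ^+ 2 in let k := 2 * (b - t) in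
  itv_int 0 1 (fun y => nearest3 (1 / 2, b) (1 / 2 - s, t) (1 / 2 + s, t) (x, y)) =
  off x ^+ 2 + 1 / 3 - b + b ^+ 2 - (pos_part A ^+ 2 - pos_part (A - k) ^+ 2) / (2 * k).
Proof.
move=> s0 tb A k; have k0 : k != 0 by rewrite gt_eqF// /k; lra.
have iP : mu.-integrable `[0, 1] (EFin \o (fun y => pos_part (A + (- k) * y) ^+ 1 : R)).
  exact/continuous_integrable_itv/continuous_pow/continuous_pos_part/affine_continuous.
rewrite (@eq_itv_int _ _ _ _ (fun y => (off x ^+ 2 + b ^+ 2 + (- (2 * b)) * y + 1 * y ^+ 2)
   + (-1) * pos_part (A + (- k) * y) ^+ 1)); last first.
  by move=> y _; rewrite nearest3_axis// expr1 mulN1r; congr (_ - pos_part _); ring.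
rewrite itv_intD; last 2 first.
- apply: continuous_integrable_itv => y; apply: cvgD; first exact: affine_continuous.
  by apply: cvgM; [exact: cvg_cst|exact: exprn_continuous].
- apply: continuous_integrable_itv => y; apply: cvgM; first exact: cvg_cst.
  exact: (continuous_pow _ 1 (continuous_pos_part _ (affine_continuous _ _))).
rewrite itv_int_quadratic itv_intZ// itv_int_pos_affine_pow ?oppr_eq0//.
by rewrite mulr1 mulr0 addr0; field.
Qed.

Lemma integral_cost b s t c : threshold c ->
  let f x := off x ^+ 2 + 1 / 3 - b + b ^+ 2 -
    (c x * (2 * s * off x - s ^+ 2 + b ^+ 2 - t ^+ 2) - 2 * (b - t) * c x ^+ 2 / 2) in
  mu.-integrable `[0, 1] (EFin \o f) /\
  itv_int 0 1 f = cost (width c) (slope c) (second_moment c) s t b.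
Proof.
move=> tc f.
have [fi fE] := moments c (1 / 3 - b + b ^+ 2) 0 1 (- (b ^+ 2 - s ^+ 2 - t ^+ 2))
  (- (2 * s)) (b - t) tc.
have E : f = fun x => 1 / 3 - b + b ^+ 2 + 0 * off x + 1 * off x ^+ 2 +
    - (b ^+ 2 - s ^+ 2 - t ^+ 2) * c x + - (2 * s) * (off x * c x) + (b - t) * c x ^+ 2.
  by apply/funext => x; rewrite /f; field.
rewrite E; split; first exact: fi.
by rewrite fE /cost /width /slope /second_moment; field.
Qed.

Lemma axis_dist3_le b s t c : 0 <= s -> t < b -> threshold c ->
  axis_dist3 b s t <= cost (width c) (slope c) (second_moment c) s t b.
Proof.
move=> s0 tb tc; have [fi <-] := integral_cost b s t c tc.
have [_ _ gi _] := unif_integralE _ (sq_bounded_nearest3 (1 / 2, b) (1 / 2 - s, t) (1 / 2 + s, t)).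
apply: le_itv_int => // x x01; rewrite slice_axis// lerD2l lerN2.
by apply: le_pos_part_gain; [lra|exact: tc.2].
Qed.

Lemma axis_dist3_eq b s t : 0 <= s -> t < b -> exists2 c, threshold c &
  axis_dist3 b s t = cost (width c) (slope c) (second_moment c) s t b.
Proof.
move=> s0 tb.
pose c x := clamp ((2 * s * off x - s ^+ 2 + b ^+ 2 - t ^+ 2) / (2 * (b - t))).
have tc : threshold c.
  split; last by move=> x _; exact: clamp01.
  have cc (f : R -> R) : continuous f -> continuous (fun x => clamp (f x)).
    move=> cf x; apply: (@continuous_min _ _ (fun=> 1) (fun x => Num.max 0 (f x))).
      exact: cst_continuous.
    by apply: (@continuous_max _ _ (fun=> 0) f); [exact: cst_continuous|exact: cf].
  apply: continuous_measurable_fun; apply: cc => x.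
  apply: cvgM; last exact: cvg_cst.
  apply: cvgB; last exact: cvg_cst.
  apply: cvgD; last exact: cvg_cst.
  apply: cvgB; last exact: cvg_cst.
  by apply: cvgM; [exact: cvg_cst|exact: continuous_off].
exists c => //; have [_ <-] := integral_cost b s t c tc.
apply: eq_itv_int => x _; rewrite slice_axis// pos_part_gain//; lra.
Qed.

(** On the box the affine function stays between 0 and 1, so its moments are not disturbed by
    clamping. *)
Lemma affine_threshold w d : in_box w d -> let c x := (w - d) / 2 + 2 * d * off x in
  [/\ threshold c, width c = w, slope c = d & second_moment c = 3 * w ^+ 2 + d ^+ 2].
Proof.
move=> [/andP[w1 w2] /andP[d1 d2]] c.
have t0 : threshold (fun=> 0 : R) by split => // x _; rewrite lexx ler01.
have mom u0 u1 u2 : itv_int 0 1 (fun x => u0 + u1 * off x + u2 * off x ^+ 2) = u0 + u1 / 4 + u2 / 12.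
  have := (moments _ u0 u1 u2 0 0 0 t0).2; rewrite !mul0r !addr0 => <-.
  by apply: eq_itv_int => x _; rewrite !mul0r !addr0.
split.
- split; first apply: continuous_measurable_fun => x.
    apply: cvgD; first exact: cvg_cst.
    by apply: cvgM; [exact: cvg_cst|exact: continuous_off].
  move=> x /off_ge0_le1 /andP[x0 x1]; rewrite /c; apply/andP; split; nra.
- rewrite /width (@eq_itv_int _ _ _ _ (fun x => (w - d) / 2 + 2 * d * off x + 0 * off x ^+ 2)).
    by rewrite mom; field.
  by move=> x _; rewrite mul0r addr0.
- rewrite /slope (@eq_itv_int _ _ _ _ (fun x => 0 + (w - d) / 2 * off x + 2 * d * off x ^+ 2)); last first.
    by move=> x _; rewrite /c; ring.
  rewrite (@eq_itv_int _ _ _ c (fun x => (w - d) / 2 + 2 * d * off x + 0 * off x ^+ 2)).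
    by rewrite !mom; field.
  by move=> x _; rewrite mul0r addr0.
- rewrite /second_moment (@eq_itv_int _ _ _ _ (fun x => ((w - d) / 2) ^+ 2
    + 2 * (w - d) * d * off x + 4 * d ^+ 2 * off x ^+ 2)); last first.
    by move=> x _; rewrite /c; field.
  by rewrite mom; field.
Qed.

End axis_symmetric.

(** * Nonnegativity of polynomials on the unit square *)

(* A bivariate polynomial with integer coefficients is the list, by powers of
   the first variable, of its coefficient lists by powers of the second one. *)
Fixpoint add_poly (p q : seq Z) : seq Z :=
  match p, q with
  | c :: p', d :: q' => Z.add c d :: add_poly p' q'
  | [::], _ => q
  | _, [::] => p
  end.

Fixpoint add_poly2 (p q : seq (seq Z)) : seq (seq Z) :=
  match p, q with
  | c :: p', d :: q' => add_poly c d :: add_poly2 p' q'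
  | [::], _ => q
  | _, [::] => p
  end.

(** Taylor shift p(x + 1), from c + (x + 1) q(x + 1) = (c + x q(x + 1)) + q(x + 1). *)
Fixpoint shift_poly (p : seq Z) : seq Z :=
  if p is c :: p' then add_poly (c :: shift_poly p') (shift_poly p') else [::].

Fixpoint shift_poly2 (p : seq (seq Z)) : seq (seq Z) :=
  if p is c :: p' then add_poly2 (c :: shift_poly2 p') (shift_poly2 p') else [::].

Definition scale2 (n : nat) (c : Z) : Z := iter n (Z.mul (Zpos (xO xH))) c.

(** The polynomial 2^n p(x / 2), whose coefficients are integers when the degree is at most [n]. *)
Fixpoint half_poly (n : nat) (p : seq Z) : seq Z :=
  if p is c :: p' then scale2 n c :: half_poly n.-1 p' else [::].

Fixpoint half_poly2 (n : nat) (p : seq (seq Z)) : seq (seq Z) :=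
  if p is c :: p' then map (scale2 n) c :: half_poly2 n.-1 p' else [::].

(** If [l] bounds a function from below, then c + min(0, l) bounds [c] plus x times that function
    for x in [0, 1]. *)
Definition horner_step (c l : Z) : Z := if (Z.leb Z0 l) then c else Z.add c l.

Fixpoint lower (p : seq Z) : Z :=
  if p is c :: p' then horner_step c (lower p') else Z0.

Fixpoint lower2 (p : seq (seq Z)) : Z :=
  if p is c :: p' then horner_step (lower c) (lower2 p') else Z0.

(* Bisection into subsquares, rescaled to the unit square, until the Horner
   lower bound is nonnegative. *)
Fixpoint nonneg_on_square (k : nat) (p : seq (seq Z)) : bool :=
  Z.leb Z0 (lower2 p) ||
  if k is k'.+1 then
    let q := half_poly2 4 (map (half_poly 4) p) in
    let r := map shift_poly q in
    [&& (size p <= 5)%N, all (fun c => size c <= 5)%N p,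
        nonneg_on_square k' q, nonneg_on_square k' (shift_poly2 q),
        nonneg_on_square k' r & nonneg_on_square k' (shift_poly2 r)]
  else false.

Section nonneg_on_square_sound.
Context {R : realFieldType}.
Implicit Types (x y : R) (p q : seq Z) (P Q : seq (seq Z)).

Definition ZtoR (z : Z) : R := (int_of_Z z)%:~R.

Lemma ZtoRD (c d : Z) : ZtoR (Z.add c d) = ZtoR c + ZtoR d.
Proof. by rewrite /ZtoR -intrD -rmorphD. Qed.

Lemma ZtoR_double (c : Z) : ZtoR (Z.mul (Zpos (xO xH)) c) = 2 * ZtoR c.
Proof. by rewrite -Z.add_diag ZtoRD mulr_natl mulr2n. Qed.

Lemma ZtoR_scale2 n (c : Z) : ZtoR (scale2 n c) = 2 ^+ n * ZtoR c.
Proof.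
elim: n => [|n IH]; first by rewrite mul1r.
by rewrite /scale2 iterS ZtoR_double IH exprS mulrA.
Qed.

Lemma ZtoR_ge0 (c : Z) : (Z.leb Z0 c) -> 0 <= ZtoR c.
Proof. by case: c => // p _; rewrite /ZtoR /= ler0n. Qed.

Lemma ZtoR_le0 (c : Z) : ~~ (Z.leb Z0 c) -> ZtoR c <= 0.
Proof. by case: c => // p _; rewrite /ZtoR /= NegzE rmorphN /= oppr_le0 ler0n. Qed.

Fixpoint horner1 p x : R := if p is c :: p' then ZtoR c + x * horner1 p' x else 0.

Fixpoint horner2 P x y : R :=
  if P is c :: P' then horner1 c y + x * horner2 P' x y else 0.

Lemma horner1D p q x : horner1 (add_poly p q) x = horner1 p x + horner1 q x.
Proof.
elim: p q => [|c p IH] [|d q] /=; rewrite ?add0r ?addr0//.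
by rewrite IH ZtoRD; ring.
Qed.

Lemma horner2D P Q x y : horner2 (add_poly2 P Q) x y = horner2 P x y + horner2 Q x y.
Proof.
elim: P Q => [|c p IH] [|d q] /=; rewrite ?add0r ?addr0//.
by rewrite IH horner1D; ring.
Qed.

Lemma horner1_shift p x : horner1 (shift_poly p) x = horner1 p (x + 1).
Proof.
elim: p => // c p IH; rewrite -[shift_poly _]/(add_poly (c :: shift_poly p) (shift_poly p)).
by rewrite horner1D /= IH; ring.
Qed.

Lemma horner2_shift P x y : horner2 (shift_poly2 P) x y = horner2 P (x + 1) y.
Proof.
elim: P => // c P IH.
rewrite -[shift_poly2 _]/(add_poly2 (c :: shift_poly2 P) (shift_poly2 P)).
by rewrite horner2D /= IH; ring.
Qed.

Lemma horner2_map_shift P x y : horner2 (map shift_poly P) x y = horner2 P x (y + 1).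
Proof. by elim: P => //= c P IH; rewrite horner1_shift IH. Qed.

Lemma horner1_half n p x : (size p <= n.+1)%N ->
  horner1 (half_poly n p) x = 2 ^+ n * horner1 p (x / 2).
Proof.
elim: p n => [|c p IH] n /=; first by rewrite mulr0.
case: n => [|n] sp.
  by case: p sp {IH} => //= _; ring.
by rewrite ZtoR_scale2 IH// exprS; field.
Qed.

Lemma horner1_scale2 n p x : horner1 (map (scale2 n) p) x = 2 ^+ n * horner1 p x.
Proof.
by elim: p => [|c p IH] /=; rewrite ?mulr0// IH ZtoR_scale2; ring.
Qed.

Lemma horner2_half n P x y : (size P <= n.+1)%N ->
  horner2 (half_poly2 n P) x y = 2 ^+ n * horner2 P (x / 2) y.
Proof.
elim: P n => [|c P IH] n /=; first by rewrite mulr0.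
case: n => [|n] sp.
  by case: P sp {IH} => // _; rewrite (horner1_scale2 0) /=; ring.
by rewrite horner1_scale2 IH// exprS; field.
Qed.

Lemma horner2_map_half n P x y : all (fun c => size c <= n.+1)%N P ->
  horner2 (map (half_poly n) P) x y = 2 ^+ n * horner2 P x (y / 2).
Proof.
elim: P => [|c P IH] /=; first by rewrite mulr0.
by move=> /andP[sc sP]; rewrite horner1_half// IH//; ring.
Qed.

Lemma horner_step_le (c l : Z) (u v x : R) : 0 <= x <= 1 ->
  ZtoR c <= u -> ZtoR l <= v -> ZtoR (horner_step c l) <= u + x * v.
Proof.
move=> /andP[x0 x1] cu lv; rewrite /horner_step.
have [l0|l0] := boolP (Z.leb Z0 l).
  by have := ZtoR_ge0 _ l0; nra.
by rewrite ZtoRD; have := ZtoR_le0 _ l0; nra.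
Qed.

Lemma lower_le p x : 0 <= x <= 1 -> ZtoR (lower p) <= horner1 p x.
Proof. by move=> x01; elim: p => //= c p IH; exact: horner_step_le. Qed.

Lemma lower2_le P x y : 0 <= x <= 1 -> 0 <= y <= 1 -> ZtoR (lower2 P) <= horner2 P x y.
Proof.
move=> x01 y01; elim: P => //= c P IH.
by apply: horner_step_le => //; exact: lower_le.
Qed.

Lemma nonneg_on_squareP k P x y : nonneg_on_square k P ->
  0 <= x <= 1 -> 0 <= y <= 1 -> 0 <= horner2 P x y.
Proof.
move=> + x01 y01.
have base (Q : seq (seq Z)) u v : 0 <= u <= 1 -> 0 <= v <= 1 -> Z.leb Z0 (lower2 Q) ->
    0 <= horner2 Q u v.
  by move=> u01 v01 l0; apply: le_trans (lower2_le Q u v u01 v01); exact: ZtoR_ge0.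
elim: k P x y x01 y01 => [|k IH] P x y x01 y01 /=.
  by rewrite orbF; exact: base.
case/orP; first exact: base.
set q := half_poly2 _ _ => /and5P[sP aP q00 q10 /andP[q01 q11]].
have qE u v : horner2 q u v = 2 ^+ 4 * (2 ^+ 4 * horner2 P (u / 2) (v / 2)).
  by rewrite horner2_half ?size_map// horner2_map_half.
have pos (u v : R) : 0 <= horner2 q u v -> 0 <= horner2 P (u / 2) (v / 2).
  by rewrite qE !pmulr_rge0// exprn_gt0.
have half (z : R) : 0 <= z <= 1 -> exists u, 0 <= u <= 1 /\ (z = u / 2 \/ z = (u + 1) / 2).
  move=> /andP[z0 z1]; have [zh|/ltW zh] := leP z (1 / 2).
    by exists (2 * z); split; [lra|left; field].
  by exists (2 * z - 1); split; [lra|right; field].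
have [u [u01 xu]] := half x x01; have [v [v01 yv]] := half y y01.
have {}q00 := IH _ u v u01 v01 q00.
have := IH _ u v u01 v01 q10; rewrite horner2_shift => {}q10.
have := IH _ u v u01 v01 q01; rewrite horner2_map_shift => {}q01.
have := IH _ u v u01 v01 q11; rewrite horner2_shift horner2_map_shift => {}q11.
by case: xu => ->; case: yv => ->; exact: pos.
Qed.

End nonneg_on_square_sound.

(** * Polynomial inequalities in the two cut fractions *)

Section wedge_polynomials.
Context {R : realFieldType}.
Implicit Types (a e : R).

Local Arguments Z_of_int : simpl never.

Lemma Z_of_intK_R (n : int) : ZtoR (Z_of_int n) = n%:~R :> R.
Proof. by rewrite /ZtoR Z_of_intK. Qed.

(* The coefficients of the polynomials below, multiplied by 26 or by 18 * 26, in
   powers of 1 - a and 1 - e.  The number 31/468 lies between the minima 0.0661797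
   and 0.06658 of the distortion for the two kinds of axes. *)
Definition point_corner_poly : seq (seq int) :=
  [:: [:: 0; 47; -130; 130; -26];
   [:: 47; -255; 390; -234; 52];
   [:: -130; 312; -260; 104; -26];
   [:: 104; -104]].

(** Equality holds at a = e = 1, where the cut triangle is the whole half square. In powers of 1 - a
    and 1 - e this zero is at the origin and the linear coefficients are positive, so the Horner
    bound is exact on small squares there and the bisection stops. The same holds for the two other
    polynomials. *)
Lemma point_corner_poly_ge0 a e : 0 <= a <= 1 -> 0 <= e <= 1 ->
  0 <= (1 - a * e) * (12 - 18 * (31 / 468) - a * e * (2 * a + e) ^+ 2)
    - 2 * ((1 - a * (a * e)) ^+ 2 + (2 - a * e * (a + e)) ^+ 2).
Proof.
move=> /andP[a0 a1] /andP[e0 e1].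
have x01 : 0 <= 1 - a <= 1 by apply/andP; split; lra.
have y01 : 0 <= 1 - e <= 1 by apply/andP; split; lra.
have check : nonneg_on_square 6 (map (map Z_of_int) point_corner_poly) by vm_compute.
have := nonneg_on_squareP 6 _ _ _ check x01 y01; clear check.
set F := (X in _ -> 0 <= X).
have -> : horner2 (map (map Z_of_int) point_corner_poly) (1 - a) (1 - e) = 26 * F.
  by rewrite {}/F /= !Z_of_intK_R; field.
by rewrite pmulr_rge0 ?ltr0n.
Qed.

Definition pair_corner_poly : seq (seq int) :=
  [:: [:: 0; 21; 52; -52; 26];
   [:: 21; -21; -104; 156; -52];
   [:: -78; 104; 52; -104; 26];
   [:: 104; -104]].

Lemma pair_corner_poly_ge0 a e : 0 <= a <= 1 -> 0 <= e <= 1 ->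
  0 <= (1 - a * e) * (2 / 3 - 31 / 468 - a * e * (a ^+ 2 + (a + e) ^+ 2) / 9)
    - (1 - a * e * (2 * a + e) / 3) ^+ 2 / 2.
Proof.
move=> /andP[a0 a1] /andP[e0 e1].
have x01 : 0 <= 1 - a <= 1 by apply/andP; split; lra.
have y01 : 0 <= 1 - e <= 1 by apply/andP; split; lra.
have check : nonneg_on_square 6 (map (map Z_of_int) pair_corner_poly) by vm_compute.
have := nonneg_on_squareP 6 _ _ _ check x01 y01; clear check.
set F := (X in _ -> 0 <= X).
have -> : horner2 (map (map Z_of_int) pair_corner_poly) (1 - a) (1 - e) = 18 * 26 * F.
  by rewrite {}/F /= !Z_of_intK_R; field.
by rewrite pmulr_rge0 ?mulr_gt0 ?ltr0n.
Qed.

Definition pair_side_poly : seq (seq int) :=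
  [:: [:: 0; 21; -52; 52; 26];
   [:: 21; -21; 52; 0; -52];
   [:: -52; 52; 78; -104; 26];
   [:: 52; 0; -104; 52; 0];
   [:: 26; -52; 26]].

Lemma pair_side_poly_ge0 a e : 0 <= a <= 1 -> 0 <= e <= 1 ->
  0 <= (1 - a * e) * (2 / 3 - 31 / 468 - a * e * ((1 - a / 3) ^+ 2 + (e / 3) ^+ 2))
    - (1 - a * e * (1 - a / 3 + e / 3)) ^+ 2 / 2.
Proof.
move=> /andP[a0 a1] /andP[e0 e1].
have x01 : 0 <= 1 - a <= 1 by apply/andP; split; lra.
have y01 : 0 <= 1 - e <= 1 by apply/andP; split; lra.
have check : nonneg_on_square 6 (map (map Z_of_int) pair_side_poly) by vm_compute.
have := nonneg_on_squareP 6 _ _ _ check x01 y01; clear check.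
set F := (X in _ -> 0 <= X).
have -> : horner2 (map (map Z_of_int) pair_side_poly) (1 - a) (1 - e) = 18 * 26 * F.
  by rewrite {}/F /= !Z_of_intK_R; field.
by rewrite pmulr_rge0 ?mulr_gt0 ?ltr0n.
Qed.

End wedge_polynomials.

(** * Algebraic lower bounds for the diagonal axis *)

Section diagonal_bounds.
Context {R : realFieldType}.
Implicit Types (a e p : R).

(* [gap] is affine in (x, y); it is positive where (p, p) is nearer than (q1, q2). *)
Definition gap p (q1 q2 x y : R) : R :=
  (x - q1) ^+ 2 + (y - q2) ^+ 2 - ((x - p) ^+ 2 + (y - p) ^+ 2).

(** Values at the vertices O = (0, 0), C = (1, 1), E = (1, 0) of the half square below the diagonal
    O C. *)
Notation gapO p q1 q2 := (gap p q1 q2 0 0).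
Notation gapC p q1 q2 := (gap p q1 q2 1 1).
Notation gapE p q1 q2 := (gap p q1 q2 1 0).

(** For an affine function with end values [x] and [y] on a segment, the quotient is the fraction of
    the segment that precedes its zero. *)
Lemma fraction01 (x y : R) : 0 <= x -> y <= 0 -> 0 < x - y ->
  [/\ 0 <= x / (x - y) <= 1, x / (x - y) * (x - y) = x & (y < 0 -> x / (x - y) < 1)].
Proof.
move=> x0 y0 xy; split.
- by rewrite divr_ge0 ?(ltW xy)//= ler_pdivrMr// mul1r; lra.
- by rewrite divfK// gt_eqF.
- by move=> y1; rewrite ltr_pdivrMr// mul1r; lra.
Qed.

Lemma fractions_lt1 (x y z : R) : 0 <= x -> y <= 0 -> 0 < x - y -> z <= 0 -> 0 < x - z ->
  y < 0 \/ z < 0 -> x / (x - y) * (x / (x - z)) < 1.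
Proof.
move=> x0 y0 xy z0 xz yz.
have [/andP[a0 a1] _ ya] := fraction01 x y x0 y0 xy.
have [/andP[b0 b1] _ zb] := fraction01 x z x0 z0 xz.
move: (x / (x - y)) (x / (x - z)) a0 a1 b0 b1 ya zb => a b a0 a1 b0 b1 ya zb.
case: yz => [/ya|/zb] lt1; nra.
Qed.

(* In the next three lemmas [a] and [e] are the fractions of the two sides of the
   half square that the bisector of the two points cuts off at a vertex. *)
Lemma point_corner_bound p (q1 q2 : R) : let gO := gapO p q1 q2 in let gC := gapC p q1 q2 in
  let gE := gapE p q1 q2 in
  0 <= gC -> gO <= 0 -> gE <= 0 -> 0 < gC - gO -> 0 < gC - gE -> gO < 0 \/ gE < 0 ->
  31 / 468 <= 2 / 3 - 4 / 3 * q1 - 2 / 3 * q2 + q1 ^+ 2 + q2 ^+ 2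
    - gC ^+ 3 / (3 * (gC - gO) * (gC - gE)).
Proof.
move=> gO gC gE gC0 gO0 gE0 al ka neg.
have [a01 aE _] := fraction01 _ _ gC0 gO0 al.
have [e01 eE _] := fraction01 _ _ gC0 gE0 ka.
have m1 := fractions_lt1 _ _ _ gC0 gO0 al gE0 ka neg.
(* Twice the area of the cut triangle times the mean of [gap] over its vertices. In this form the
   term is polynomial in the points, and [a] and [e] can be generalized to free parameters. *)
have -> : gC ^+ 3 / (3 * (gC - gO) * (gC - gE)) =
    gC / (gC - gO) * (gC / (gC - gE)) * (gC - (gC / (gC - gO) * (gC - gO)
       + gC / (gC - gE) * (gC - gE)) / 3).
  by rewrite aE eE; field; rewrite !gt_eqF.
move: (gC / (gC - gO)) (gC / (gC - gE)) a01 e01 m1 {aE eE gC0 gO0 gE0 al ka neg}.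
move=> a e a01 e01 m1.
have P := point_corner_poly_ge0 a e a01 e01.
have m0 : 0 <= a * e by case/andP: a01 => ? _; case/andP: e01 => ? _; exact: mulr_ge0.
rewrite -subr_ge0 -(@pmulr_rge0 _ (18 * (1 - a * e))); last by rewrite mulr_gt0//; lra.
set L := (X in 0 <= X).
(* The squares vanish when (q1, q2) is the centroid of its cell and (p, p) the projection of the
   centroid of the cut triangle to the diagonal. *)
have -> : L = 36 * (a * e * (1 - a * e)) * (1 - p - (2 * a + e) / 6) ^+ 2
    + 18 * ((1 - a * e) * (1 - q1) - (1 - a * (a * e)) / 3) ^+ 2
    + 18 * ((1 - a * e) * (1 - q2) - (2 - a * e * (a + e)) / 3) ^+ 2
    + ((1 - a * e) * (12 - 18 * (31 / 468) - a * e * (2 * a + e) ^+ 2)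
    - 2 * ((1 - a * (a * e)) ^+ 2 + (2 - a * e * (a + e)) ^+ 2)).
  by rewrite /L /gC /gO /gE /gap; move: (31 / 468) => D0; field.
have mm : 0 <= a * e * (1 - a * e) by apply: mulr_ge0; lra.
by do ![apply: addr_ge0 => //]; apply: mulr_ge0 (sqr_ge0 _); lra.
Qed.

Lemma pair_corner_bound p (q1 q2 : R) : let gO := - gapO p q1 q2 in let gC := - gapC p q1 q2 in
  let gE := - gapE p q1 q2 in
  0 <= gC -> gO <= 0 -> gE <= 0 -> 0 < gC - gO -> 0 < gC - gE -> gO < 0 \/ gE < 0 ->
  31 / 468 <= 2 / 3 - 2 * p + 2 * p ^+ 2 - gC ^+ 3 / (3 * (gC - gO) * (gC - gE)).
Proof.
move=> gO gC gE gC0 gO0 gE0 al ka neg.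
have [a01 aE _] := fraction01 _ _ gC0 gO0 al.
have [e01 eE _] := fraction01 _ _ gC0 gE0 ka.
have m1 := fractions_lt1 _ _ _ gC0 gO0 al gE0 ka neg.
have -> : gC ^+ 3 / (3 * (gC - gO) * (gC - gE)) =
    gC / (gC - gO) * (gC / (gC - gE)) * (gC - (gC / (gC - gO) * (gC - gO)
       + gC / (gC - gE) * (gC - gE)) / 3).
  by rewrite aE eE; field; rewrite !gt_eqF.
move: (gC / (gC - gO)) (gC / (gC - gE)) a01 e01 m1 {aE eE gC0 gO0 gE0 al ka neg}.
move=> a e a01 e01 m1.
have P := pair_corner_poly_ge0 a e a01 e01.
have m0 : 0 <= a * e by case/andP: a01 => ? _; case/andP: e01 => ? _; exact: mulr_ge0.
rewrite -subr_ge0 -(@pmulr_rge0 _ (1 - a * e)); last by lra.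
set L := (X in 0 <= X).
have -> : L = 2 * ((1 - a * e) * (1 - p) - (1 - a * e * (2 * a + e) / 3) / 2) ^+ 2
    + a * e * (1 - a * e) * (1 - q1 - a / 3) ^+ 2
    + a * e * (1 - a * e) * (1 - q2 - (a + e) / 3) ^+ 2
    + ((1 - a * e) * (2 / 3 - 31 / 468 - a * e * (a ^+ 2 + (a + e) ^+ 2) / 9)
    - (1 - a * e * (2 * a + e) / 3) ^+ 2 / 2).
  by rewrite /L /gC /gO /gE /gap; move: (31 / 468) => D0; field.
have mm : 0 <= a * e * (1 - a * e) by apply: mulr_ge0; lra.
by do ![apply: addr_ge0 => //]; apply: mulr_ge0 (sqr_ge0 _); lra.
Qed.

Lemma pair_side_bound p (q1 q2 : R) : let gO := - gapO p q1 q2 in let gC := - gapC p q1 q2 in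
  let gE := - gapE p q1 q2 in
  0 <= gE -> gO <= 0 -> gC <= 0 -> 0 < gE - gO -> 0 < gE - gC -> gO < 0 \/ gC < 0 ->
  31 / 468 <= 2 / 3 - 2 * p + 2 * p ^+ 2 - gE ^+ 3 / (3 * (gE - gO) * (gE - gC)).
Proof.
move=> gO gC gE gE0 gO0 gC0 al ka neg.
have [a01 aE _] := fraction01 _ _ gE0 gO0 al.
have [e01 eE _] := fraction01 _ _ gE0 gC0 ka.
have m1 := fractions_lt1 _ _ _ gE0 gO0 al gC0 ka neg.
have -> : gE ^+ 3 / (3 * (gE - gO) * (gE - gC)) =
    gE / (gE - gO) * (gE / (gE - gC)) * (gE - (gE / (gE - gO) * (gE - gO)
       + gE / (gE - gC) * (gE - gC)) / 3).
  by rewrite aE eE; field; rewrite !gt_eqF.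
move: (gE / (gE - gO)) (gE / (gE - gC)) a01 e01 m1 {aE eE gC0 gO0 gE0 al ka neg}.
move=> a e a01 e01 m1.
have P := pair_side_poly_ge0 a e a01 e01.
have m0 : 0 <= a * e by case/andP: a01 => ? _; case/andP: e01 => ? _; exact: mulr_ge0.
rewrite -subr_ge0 -(@pmulr_rge0 _ (1 - a * e)); last by lra.
set L := (X in 0 <= X).
have -> : L = 2 * ((1 - a * e) * p - (1 - a * e * (1 - a / 3 + e / 3)) / 2) ^+ 2
    + a * e * (1 - a * e) * (q1 - (1 - a / 3)) ^+ 2
    + a * e * (1 - a * e) * (q2 - e / 3) ^+ 2
    + ((1 - a * e) * (2 / 3 - 31 / 468 - a * e * ((1 - a / 3) ^+ 2 + (e / 3) ^+ 2))
    - (1 - a * e * (1 - a / 3 + e / 3)) ^+ 2 / 2).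
  by rewrite /L /gC /gO /gE /gap; move: (31 / 468) => D0; field.
have mm : 0 <= a * e * (1 - a * e) by apply: mulr_ge0; lra.
by do ![apply: addr_ge0 => //]; apply: mulr_ge0 (sqr_ge0 _); lra.
Qed.

End diagonal_bounds.

(** * Symmetry with respect to the diagonal *)

Section diagonal_symmetric.
Context {R : realType}.
Notation mu := (@lebesgue_measure R).
Implicit Types (p u v w x y : R) (z : R * R) (f : R * R -> R).

Definition affine u v w z : R := u + v * z.1 + w * z.2.

Definition below_diag f z : R := if z.2 <= z.1 then pos_part (f z) else 0.

Lemma sq_bounded_below_diag u v w : sq_bounded (below_diag (affine u v w)).
Proof.
have ma : measurable_fun (setT : set (plane R)) (affine u v w).
  by apply: measurable_funD; [apply: measurable_funD|]; rewrite //; exact: measurable_funM.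
split.
- apply: measurable_fun_ifT => //.
    apply: measurable_fun_ler; [exact: measurable_snd|exact: measurable_fst].
  exact: measurable_maxr.
- by move=> z; rewrite /below_diag; case: ifP => // _; exact: pos_part_nneg.
- exists (`|u| + `|v| + `|w|) => x y /andP[x0 x1] /andP[y0 y1].
  have M0 : 0 <= `|u| + `|v| + `|w| by rewrite !addr_ge0.
  rewrite /below_diag /=; case: ifP => // _; rewrite /pos_part ge_max M0 andbT.
  rewrite /affine /=; apply: le_trans (ler_norm _) _.
  apply: (le_trans (ler_normD _ _)); apply: lerD.
    apply: (le_trans (ler_normD _ _)); rewrite lerD2l normrM (ger0_norm x0).
    by rewrite ler_piMr.
  by rewrite normrM (ger0_norm y0) ler_piMr.
Qed.

Lemma slice_below_diag u v w x : 0 <= x <= 1 -> w != 0 ->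
  itv_int 0 1 (fun y => below_diag (affine u v w) (x, y)) =
  (pos_part (u + (v + w) * x) ^+ 2 - pos_part (u + v * x) ^+ 2) / (2 * w).
Proof.
move=> /andP[x0 x1] w0.
transitivity (itv_int 0 x (fun y => pos_part ((u + v * x) + w * y) ^+ 1)).
  have E : (`[0, 1] `&` `[0, x])%classic = `[0, x]%classic :> set R.
    apply/seteqP; split => [y []//|y /=]; rewrite !in_itv /= => /andP[y0 yx].
    by rewrite y0 yx (le_trans yx x1).
  rewrite /itv_int -E Rintegral_mkcondr; apply: eq_Rintegral => y.
  rewrite inE /= in_itv /= => /andP[y0 y1].
  rewrite patchE /below_diag /= expr1; case: ifPn => yx.
    by rewrite ifT// inE /= in_itv /= y0.
  by rewrite ifF//; apply/negbTE; apply: contra yx; rewrite inE /= in_itv /= => /andP[].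
rewrite itv_int_pos_affine_pow// mulr0 addr0.
by congr ((pos_part _ ^+ 2 - _) / _); ring.
Qed.

Lemma pos_affine_sqr_integral u v : 0 < v ->
  itv_int 0 1 (fun x => pos_part (u + v * x) ^+ 2) =
  (pos_part (u + v) ^+ 3 - pos_part u ^+ 3) / (3 * v).
Proof.
by move=> v0; rewrite itv_int_pos_affine_pow ?gt_eqF// mulr1 mulr0 addr0.
Qed.

(** An upper bound for the saving is enough, so the subtracted positive parts are dropped; they
    vanish when only one vertex is cut off. *)
Lemma below_diag_le u v w u' v' k : w != 0 -> 0 < v' -> 0 < k -> 0 <= u' + v' ->
  (forall x, 0 <= x <= 1 ->
    (pos_part (u + (v + w) * x) ^+ 2 - pos_part (u + v * x) ^+ 2) / (2 * w) <=
    pos_part (u' + v' * x) ^+ 2 / (2 * k)) ->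
  sq_int (below_diag (affine u v w)) <= (u' + v') ^+ 3 / (6 * v' * k).
Proof.
move=> w0 v'0 k0 uv0 H.
have [_ _ bi _] := unif_integralE _ (sq_bounded_below_diag u v w).
have ci : mu.-integrable `[0, 1] (EFin \o (fun x => pos_part (u' + v' * x) ^+ 2 : R)).
  exact/continuous_integrable_itv/continuous_pow/continuous_pos_part/affine_continuous.
have ci' : mu.-integrable `[0, 1] (EFin \o (fun x => (2 * k)^-1 * pos_part (u' + v' * x) ^+ 2 : R)).
  apply: continuous_integrable_itv => x; apply: cvgM; first exact: cvg_cst.
  exact: (continuous_pow _ 2 (continuous_pos_part _ (affine_continuous _ _))).
apply: (@le_trans _ _ (itv_int 0 1 (fun x => (2 * k)^-1 * pos_part (u' + v' * x) ^+ 2))).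
  apply: le_itv_int => // x x01; rewrite slice_below_diag// [leRHS]mulrC; exact: H.
rewrite itv_intZ// pos_affine_sqr_integral// pos_part_ge0//.
rewrite [leLHS](_ : _ = ((u' + v') ^+ 3 - pos_part u' ^+ 3) / (6 * v' * k)); last first.
  by field; rewrite !gt_eqF.
rewrite ler_pM2r ?invr_gt0 ?mulr_gt0//.
by rewrite gerBl exprn_ge0// pos_part_nneg.
Qed.

Lemma below_diag_corner u v w : 0 < w -> 0 < v + w -> 0 <= u + v + w ->
  sq_int (below_diag (affine u v w)) <= (u + v + w) ^+ 3 / (6 * (v + w) * w).
Proof.
move=> w0 vw0 uvw0; rewrite -addrA; apply: below_diag_le => //; first by rewrite gt_eqF.
  by rewrite addrA.
move=> x x01; rewrite ler_pM2r ?invr_gt0 ?mulr_gt0//.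
by rewrite gerBl sqr_ge0.
Qed.

Lemma below_diag_side u v w : w < 0 -> 0 < v -> 0 <= u + v ->
  sq_int (below_diag (affine u v w)) <= (u + v) ^+ 3 / (6 * v * - w).
Proof.
move=> w0 v0 uv0; apply: below_diag_le => //; rewrite ?lt_eqF// ?oppr_gt0//.
move=> x x01; move: (pos_part (u + (v + w) * x)) (pos_part (u + v * x)) => a b.
have -> : (a ^+ 2 - b ^+ 2) / (2 * w) = (b ^+ 2 - a ^+ 2) / (2 * - w).
  by field; rewrite ?oppr_eq0 lt_eqF.
rewrite ler_pM2r ?invr_gt0 ?mulr_gt0 ?oppr_gt0//.
by rewrite gerBl sqr_ge0.
Qed.

Lemma below_diag_npos u v w : u <= 0 -> u + v <= 0 -> u + v + w <= 0 ->
  sq_int (below_diag (affine u v w)) = 0.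
Proof.
move=> u0 uv0 uvw0; rewrite -[RHS](sq_int_cst 0).
apply: eq_itv_int => x /andP[x0 x1]; apply: eq_itv_int => y /andP[y0 y1].
rewrite /below_diag /=; case: ifP => // yx; rewrite pos_part_le0// /affine /=.
(* Barycentric coordinates with respect to the vertices O, E, C. *)
have -> : u + v * x + w * y = u * (1 - x) + (u + v) * (x - y) + (u + v + w) * y by ring.
rewrite -oppr_ge0 !opprD -!mulNr.
by apply: addr_ge0; [apply: addr_ge0|]; apply: mulr_ge0; lra.
Qed.

Definition diag_dist3 p (q1 q2 : R) : R := dist3 (p, p) (q1, q2) (q2, q1).

Lemma sq_bounded_swap f : sq_bounded f -> sq_bounded (fun z => f (z.2, z.1)).
Proof.
move=> [mf f0 [M fM]]; split.
- by apply: measurableT_comp => //; apply: measurable_fun_pair.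
- by move=> z; exact: f0.
- by exists M => x y x01 y01; exact: fM.
Qed.

Definition nearest_sym (q1 q2 : R) z : R := Num.min (sqdist z (q1, q2)) (sqdist z (q2, q1)).

Lemma nearest_symE (q1 q2 x y : R) : q2 < q1 ->
  nearest_sym q1 q2 (x, y) = if y <= x then sqdist (x, y) (q1, q2) else sqdist (x, y) (q2, q1).
Proof.
move=> q21; rewrite /nearest_sym; case: ifPn => [yx|].
  by apply/min_idPl; rewrite /sqdist /= -subr_ge0; nra.
by rewrite -ltNge => xy; apply/min_idPr; rewrite /sqdist /= -subr_ge0; nra.
Qed.

Lemma sq_int_nearest_sym (q1 q2 : R) : q2 < q1 -> sq_int (nearest_sym q1 q2) =
  2 / 3 - 4 / 3 * q1 - 2 / 3 * q2 + q1 ^+ 2 + q2 ^+ 2.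
Proof.
move=> q21.
pose h x := (1 / 3 + q1 ^+ 2 + q2 ^+ 2 - q1 + (q1 - q2)) - (q1 - q2)
  + (- (2 * q1) + 2 * (q1 - q2)) * x + (1 - (q1 - q2)) * x ^+ 2.
transitivity (itv_int 0 1 h); last by rewrite itv_int_quadratic; field.
apply: eq_itv_int => x /andP[x0 x1].
have iP : mu.-integrable `[0, 1] (EFin \o (fun y => pos_part (- x + 1 * y) ^+ 1 : R)).
  exact/continuous_integrable_itv/continuous_pow/continuous_pos_part/affine_continuous.
rewrite (@eq_itv_int _ _ _ _ (fun y => (x ^+ 2 + q1 ^+ 2 + q2 ^+ 2 - 2 * q1 * x
   + (- (2 * q1) + 2 * (q1 - q2)) * y + 1 * y ^+ 2)
   + - (2 * (q1 - q2)) * pos_part (- x + 1 * y) ^+ 1)); last first.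
  move=> y _; rewrite nearest_symE// expr1 mul1r /sqdist /=; case: ifPn => yx.
    by rewrite pos_part_le0; [ring|lra].
  by rewrite -ltNge in yx; rewrite pos_part_ge0; [ring|lra].
rewrite itv_intD; last 2 first.
- apply: continuous_integrable_itv => y; apply: cvgD; first exact: affine_continuous.
  by apply: cvgM; [exact: cvg_cst|exact: exprn_continuous].
- apply: continuous_integrable_itv => y; apply: cvgM; first exact: cvg_cst.
  exact: (continuous_pow _ 1 (continuous_pos_part _ (affine_continuous _ _))).
rewrite itv_int_quadratic itv_intZ// itv_int_pos_affine_pow ?oner_neq0//.
rewrite mulr1 mulr0 addr0 (pos_part_le0 (- x)); last by lra.
by rewrite pos_part_ge0 /h; [field|lra].
Qed.

Lemma sq_int_sqdist p : sq_int (sqdist ^~ (p, p)) = 2 / 3 - 2 * p + 2 * p ^+ 2.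
Proof.
have b1 := sq_bounded_sqr 1 0 (- p); have b2 := sq_bounded_sqr 0 1 (- p).
transitivity (sq_int (fun z : R * R =>
    (1 * z.1 + 0 * z.2 + - p) ^+ 2 + (0 * z.1 + 1 * z.2 + - p) ^+ 2)).
  by congr sq_int; apply/funext => z; rewrite /sqdist /= !mul1r !mul0r addr0 add0r.
by rewrite (sq_intD b1 b2) !sq_int_sqr; field.
Qed.

(** Both integrands are symmetric, so they are compared only below the diagonal; the correction
    counts once on each side, hence the factor 2. *)
Lemma diag_lower f f0 p (q1 q2 : R) : q2 < q1 -> sq_bounded f0 -> sq_bounded (below_diag f) ->
  (forall x y, y <= x -> f0 (x, y) <= Num.min (sqdist (x, y) (p, p)) (sqdist (x, y) (q1, q2))
     + pos_part (f (x, y))) ->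
  (forall x y, f0 (x, y) = f0 (y, x)) ->
  sq_int f0 <= diag_dist3 p q1 q2 + 2 * sq_int (below_diag f).
Proof.
move=> q21 b0 bf H sym.
have bn := sq_bounded_nearest3 (p, p) (q1, q2) (q2, q1).
have bs := sq_bounded_swap _ bf; have bd := sq_boundedD bf bs.
have -> : diag_dist3 p q1 q2 + 2 * sq_int (below_diag f) =
    sq_int (fun z => nearest3 (p, p) (q1, q2) (q2, q1) z
      + (below_diag f z + below_diag f (z.2, z.1))).
  by rewrite (sq_intD bn bd) (sq_intD bf bs) sq_int_swap// mulr_natl mulr2n.
apply: le_sq_int => // [|x y _ _]; first exact: sq_boundedD.
have E (a b : R) : b <= a -> nearest3 (p, p) (q1, q2) (q2, q1) (a, b) =
    Num.min (sqdist (a, b) (p, p)) (sqdist (a, b) (q1, q2)).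
  move=> ba; rewrite /nearest3 -minA.
  by rewrite -/(nearest_sym q1 q2 (a, b)) nearest_symE// ba.
have nsym (a b : R) : nearest3 (p, p) (q1, q2) (q2, q1) (a, b) =
    nearest3 (p, p) (q1, q2) (q2, q1) (b, a).
  by rewrite /nearest3 /sqdist /= -!minA [in RHS](minC (_ + (a - q2) ^+ 2)) ![(b - _) ^+ 2 + _]addrC.
have pos a b : 0 <= below_diag f (a, b) by case: bf.
have bE a b : b <= a -> below_diag f (a, b) = pos_part (f (a, b)).
  by move=> ba; rewrite /below_diag /= ba.
have [yx|/ltW xy] := leP y x; rewrite /=.
  by rewrite E//; apply: le_trans (H _ _ yx) _; rewrite lerD2l (bE _ _ yx) lerDl.
by rewrite nsym sym E//; apply: le_trans (H _ _ xy) _; rewrite lerD2l (bE _ _ xy) lerDr.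
Qed.

Lemma gap_affine p (q1 q2 : R) x y : gap p q1 q2 x y =
  affine (gap p q1 q2 0 0) (gap p q1 q2 1 0 - gap p q1 q2 0 0)
    (gap p q1 q2 1 1 - gap p q1 q2 1 0) (x, y).
Proof. by rewrite /affine /gap /=; ring. Qed.

(** The left side is the cost of the pair alone; (p, p) saves at most the positive part of [gap] on
    each half. *)
Lemma diag_lower_pair p (q1 q2 : R) : q2 < q1 ->
  2 / 3 - 4 / 3 * q1 - 2 / 3 * q2 + q1 ^+ 2 + q2 ^+ 2 <=
  diag_dist3 p q1 q2 + 2 * sq_int (below_diag
    (affine (gap p q1 q2 0 0) (gap p q1 q2 1 0 - gap p q1 q2 0 0)
      (gap p q1 q2 1 1 - gap p q1 q2 1 0))).
Proof.
move=> q21; rewrite -sq_int_nearest_sym//; apply: diag_lower => //.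
- by apply: sq_bounded_min; exact: sq_bounded_sqdist.
- exact: sq_bounded_below_diag.
- move=> x y yx; rewrite nearest_symE// yx -gap_affine /gap.
  rewrite -[X in pos_part X]/(sqdist (x, y) (q1, q2) - sqdist (x, y) (p, p)).
  move: (sqdist _ (q1, q2)) (sqdist _ (p, p)) => a b.
  have [ba|/ltW ab] := leP b a.
    by rewrite pos_part_ge0; lra.
  by have := pos_part_nneg (a - b); lra.
- by move=> x y; rewrite /nearest_sym /sqdist /= minC ![(y - _) ^+ 2 + _]addrC.
Qed.

(** Here the left side is the cost of (p, p) alone, and the saving of the pair has the opposite
    sign. *)
Lemma diag_lower_point p (q1 q2 : R) : q2 < q1 ->
  2 / 3 - 2 * p + 2 * p ^+ 2 <= diag_dist3 p q1 q2 + 2 * sq_int (below_diag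
    (affine (- gap p q1 q2 0 0) (- gap p q1 q2 1 0 - - gap p q1 q2 0 0)
      (- gap p q1 q2 1 1 - - gap p q1 q2 1 0))).
Proof.
move=> q21; rewrite -sq_int_sqdist; apply: diag_lower => //.
- exact: sq_bounded_sqdist.
- exact: sq_bounded_below_diag.
- move=> x y yx; rewrite (_ : affine _ _ _ _ = - gap p q1 q2 x y); last first.
    by rewrite (gap_affine p q1 q2 x y) /affine /=; ring.
  rewrite /gap -[X in pos_part X]/(- (sqdist (x, y) (q1, q2) - sqdist (x, y) (p, p))).
  move: (sqdist _ (q1, q2)) (sqdist _ (p, p)) => a b.
  have [ba|/ltW ab] := leP b a.
    by have := pos_part_nneg (- (a - b)); lra.
  by rewrite pos_part_ge0; lra.
- by move=> x y; rewrite /sqdist /= addrC.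
Qed.

Lemma double_wedge (a b c : R) : 0 < b -> 0 < c -> 2 * (a / (6 * b * c)) = a / (3 * b * c).
Proof. by move=> b0 c0; field; rewrite !gt_eqF. Qed.

Lemma diag_point_corner p (q1 q2 : R) : q2 < q1 -> 0 < gap p q1 q2 1 1 ->
  gap p q1 q2 0 0 < 0 -> gap p q1 q2 1 0 <= 0 -> 31 / 468 <= diag_dist3 p q1 q2.
Proof.
move=> q21 gC gO gE; have L := diag_lower_pair p q1 q2 q21.
have := point_corner_bound p q1 q2 (ltW gC) (ltW gO) gE.
move: L gC gO gE; move: (gap p q1 q2 1 1) (gap p q1 q2 0 0) (gap p q1 q2 1 0) => C O E.
move=> L C0 O0 E0 /(_ _ _ (or_introl O0)) B.
have CO : 0 < C - O by lra.
have CE : 0 < C - E by lra.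
have {}B := B CO CE.
have EE : O + (E - O) + (C - E) = C by ring.
have DD : E - O + (C - E) = C - O by ring.
have := below_diag_corner O (E - O) (C - E) CE.
rewrite EE DD => /(_ CO (ltW C0)); move: L B; rewrite -double_wedge//.
move: (_ / _) (sq_int _) (diag_dist3 _ _ _) (q1 ^+ 2) (q2 ^+ 2) => W I D a b; lra.
Qed.

Lemma diag_pair_corner p (q1 q2 : R) : q2 < q1 -> gap p q1 q2 1 1 <= 0 ->
  0 < gap p q1 q2 0 0 -> 0 < gap p q1 q2 1 0 -> 31 / 468 <= diag_dist3 p q1 q2.
Proof.
move=> q21 gC gO gE; have L := diag_lower_point p q1 q2 q21.
have := pair_corner_bound p q1 q2.
move: L gC gO gE; move: (gap p q1 q2 1 1) (gap p q1 q2 0 0) (gap p q1 q2 1 0) => C' O' E'.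
rewrite -!oppr_lt0 -oppr_ge0; move: (- C') (- O') (- E') => C O E.
move=> L C0 O0 E0 /(_ C0 (ltW O0) (ltW E0) _ _ (or_introl O0)) B.
have CO : 0 < C - O by lra.
have CE : 0 < C - E by lra.
have {}B := B CO CE.
have EE : O + (E - O) + (C - E) = C by ring.
have DD : E - O + (C - E) = C - O by ring.
have := below_diag_corner O (E - O) (C - E) CE.
rewrite EE DD => /(_ CO C0); move: L B; rewrite -double_wedge//.
move: (_ / _) (sq_int _) (diag_dist3 _ _ _) (p ^+ 2) => W I D a; lra.
Qed.

Lemma diag_pair_side p (q1 q2 : R) : q2 < q1 -> gap p q1 q2 1 0 < 0 ->
  0 <= gap p q1 q2 0 0 -> 0 <= gap p q1 q2 1 1 ->
  0 < gap p q1 q2 0 0 \/ 0 < gap p q1 q2 1 1 -> 31 / 468 <= diag_dist3 p q1 q2.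
Proof.
move=> q21 gE gO gC gOC; have L := diag_lower_point p q1 q2 q21.
have := pair_side_bound p q1 q2.
move: L gC gO gE gOC; move: (gap p q1 q2 1 1) (gap p q1 q2 0 0) (gap p q1 q2 1 0) => C' O' E'.
move=> L C0 O0 E0 OC B.
have {}OC : - O' < 0 \/ - C' < 0 by rewrite !oppr_lt0.
rewrite -oppr_le0 in C0; rewrite -oppr_le0 in O0; rewrite -oppr_gt0 in E0.
move: (- C') (- O') (- E') L B C0 O0 E0 OC => C O E L B C0 O0 E0 OC.
have {}B := B (ltW E0) O0 C0 _ _ OC.
have EO : 0 < E - O by lra.
have EC : 0 < E - C by lra.
have {}B := B EO EC.
have EE : O + (E - O) = E by ring.
have CE0 : C - E < 0 by lra.
have := below_diag_side O (E - O) (C - E) CE0 EO.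
rewrite EE opprB => /(_ (ltW E0)); move: L B; rewrite -double_wedge//.
move: (_ / _) (sq_int _) (diag_dist3 _ _ _) (p ^+ 2) => W I D a; lra.
Qed.

(** Reflection in the antidiagonal exchanges O and C, fixes E and keeps [q2 < q1]; it halves the
    number of cases. *)
Lemma diag_dist3_flip p (q1 q2 : R) :
  diag_dist3 (1 - p) (1 - q2) (1 - q1) = diag_dist3 p q1 q2.
Proof.
rewrite -[RHS]dist3_flip -[RHS]dist3_swap -[RHS]dist3_flip /diag_dist3.
by rewrite /refl_horiz /refl_diag /=.
Qed.

(** The signs of [gap] at O, C, E tell which vertex is cut off. If none is, the pair alone costs at
    least 1/9, or the point alone at least 1/6. *)
Lemma diag_dist3_ge p (q1 q2 : R) : q2 < q1 -> 31 / 468 <= diag_dist3 p q1 q2.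
Proof.
move=> q21.
(* As [q2 < q1], the affine function [gap] is smaller at (1, 0) than at (0, 1), and these two values
   have the same sum as those at O and C. *)
have mid : 2 * gap p q1 q2 1 0 < gap p q1 q2 0 0 + gap p q1 q2 1 1 by rewrite /gap; lra.
have q21' : 1 - q1 < 1 - q2 by lra.
have hfC : gap (1 - p) (1 - q2) (1 - q1) 1 1 = gap p q1 q2 0 0 by rewrite /gap; ring.
have hfO : gap (1 - p) (1 - q2) (1 - q1) 0 0 = gap p q1 q2 1 1 by rewrite /gap; ring.
have hfE : gap (1 - p) (1 - q2) (1 - q1) 1 0 = gap p q1 q2 1 0 by rewrite /gap; ring.
have [C0|C0] := ltP (gap p q1 q2 1 1) 0; have [ O0|O0] := ltP (gap p q1 q2 0 0) 0.
- have := diag_lower_pair p q1 q2 q21; rewrite below_diag_npos.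
  + have := sqr_ge0 (q1 - 2 / 3); have := sqr_ge0 (q2 - 1 / 3); lra.
  + exact: ltW.
  + lra.
  + lra.
- move: O0; rewrite le_eqVlt => /predU1P[ O0|O0].
    have := diag_lower_pair p q1 q2 q21; rewrite below_diag_npos -?O0.
    + have := sqr_ge0 (q1 - 2 / 3); have := sqr_ge0 (q2 - 1 / 3); lra.
    + by [].
    + lra.
    + lra.
  have [E0|E0] := leP (gap p q1 q2 1 0) 0; last exact: diag_pair_corner (ltW C0) O0 E0.
  by rewrite -diag_dist3_flip; apply: diag_point_corner => //; rewrite ?hfC ?hfO ?hfE.
- move: C0; rewrite le_eqVlt => /predU1P[C0|C0].
    have := diag_lower_pair p q1 q2 q21; rewrite below_diag_npos -?C0.
    + have := sqr_ge0 (q1 - 2 / 3); have := sqr_ge0 (q2 - 1 / 3); lra.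
    + exact: ltW.
    + lra.
    + lra.
  have [E0|E0] := leP (gap p q1 q2 1 0) 0; first exact: diag_point_corner C0 O0 E0.
  by rewrite -diag_dist3_flip; apply: diag_pair_corner => //; rewrite ?hfC ?hfO ?hfE// ltW.
- have [E0|E0] := ltP (gap p q1 q2 1 0) 0; last first.
    have := diag_lower_point p q1 q2 q21; rewrite below_diag_npos.
    + have := sqr_ge0 (p - 1 / 2); lra.
    + by rewrite oppr_le0.
    + lra.
    + lra.
  have [ O1|O1] := eqVneq (gap p q1 q2 0 0) 0; last first.
    by apply: diag_pair_side => //; left; rewrite lt_neqAle eq_sym O1.
  have [C1|C1] := eqVneq (gap p q1 q2 1 1) 0; last first.
    by apply: diag_pair_side => //; right; rewrite lt_neqAle eq_sym C1.
  have := diag_lower_pair p q1 q2 q21; rewrite below_diag_npos ?O1 ?C1.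
  + have := sqr_ge0 (q1 - 2 / 3); have := sqr_ge0 (q2 - 1 / 3); lra.
  + by [].
  + lra.
  + lra.
Qed.

End diagonal_symmetric.

(** * Optimal triples symmetric in the line x_1 = 1/2 *)

Section optimal_symmetric_triples.
Context {R : realType}.
Implicit Types (b s t w d : R) (a c p q z : R * R) (alpha : set (R * R)).

Lemma axis_dist3_box w d : in_box w d -> exists b s t,
  axis_dist3 b s t <= 5 / 12 - gain w d / 288.
Proof.
move=> wd; have [tc wE dE NE] := affine_threshold w d wd.
have [/andP[w1 w2] /andP[d1 d2]] := wd.
have w0 : 0 < w by lra.
have w20 : 0 < 2 - w by lra.
pose N := 3 * w ^+ 2 + d ^+ 2.
(* After clearing denominators this is exactly the condition that the pair lies below the axis
   point. *)
have N6 : N < 6 * w by rewrite /N; nra.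
exists ((12 - N) / (12 * (2 - w))), ((3 * w + d) / (12 * w)), (N / (12 * w)).
apply: le_trans (axis_dist3_le _ _ _ _ _ _ tc) _.
- by rewrite divr_ge0//; lra.
- have -> : N / (12 * w) = N * (2 - w) / (12 * w * (2 - w)) by field; rewrite !gt_eqF.
  have -> : (12 - N) / (12 * (2 - w)) = (12 - N) * w / (12 * w * (2 - w)).
    by field; rewrite !gt_eqF.
  by rewrite ltr_pM2r ?invr_gt0 ?mulr_gt0//; lra.
rewrite wE dE NE -/N cost_decomposition//; last by lra.
rewrite !subrr expr0n /= !mulr0 !addr0 (_ : 3 * w * (2 - w) - d ^+ 2 = 6 * w - N).
  by rewrite subrr mul0r addr0.
by rewrite /N; ring.
Qed.

Lemma best3_le_box a c z w d : best3 a c z -> in_box w d ->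
  dist3 a c z <= 5 / 12 - gain w d / 288.
Proof.
move=> best /axis_dist3_box [b [s [t]]]; apply: le_trans; exact: best.
Qed.

Lemma best3_le a c z : best3 a c z -> dist3 a c z <= (6 + (61 + 80 / 100) / 100) / 100.
Proof.
move=> /best3_le_box /(_ approx_in_box); have := gain_approx (R := R).
rewrite ler_norml => /andP[_]; move: (gain _ _) (dist3 _ _ _) => g D; lra.
Qed.

(** The triple costs no more than the affine competitor with the same [w] and [d], so every
    nonnegative term of the decomposition is zero; this determines [s], [t], [b] and [N]. *)
Lemma axis_best b s t : 0 <= s -> t < b ->
  best3 (1 / 2, b) (1 / 2 - s, t) (1 / 2 + s, t) ->
  exists w d, let N := 3 * w ^+ 2 + d ^+ 2 in
  [/\ box_max w d, s = (3 * w + d) / (12 * w), t = N / (12 * w),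
      b = (12 - N) / (12 * (2 - w)) & axis_dist3 b s t = 5 / 12 - gain w d / 288].
Proof.
move=> s0 tb best; have [c tc E] := axis_dist3_eq b s t s0 tb.
have [/andP[w0 w2] dN N6] := threshold_bounds c tc.
move: (width c) (slope c) (second_moment c) E w0 w2 dN N6 => w d N E w0 w2 dN N6.
have D6 := best3_le _ _ _ best; rewrite -/(axis_dist3 b s t) E in D6.
(* The extreme widths 0 and 2 leave the pair or the axis point without a cell, at a cost of at least
   1/6 or 5/48. *)
have {}w0 : 0 < w.
  rewrite lt_neqAle w0 andbT; apply/eqP => wE; rewrite -wE in dN N6 D6.
  have d20 := sqr_ge0 d; have N0 : N = 0 by lra.
  move: D6; rewrite /cost N0; have dd : d = 0 by apply/eqP; rewrite -sqrf_eq0 eq_le d20 andbT; lra.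
  rewrite dd; have := sqr_ge0 (b - 1 / 2); lra.
have {}w2 : w < 2.
  rewrite lt_neqAle w2 andbT; apply/eqP => wE; rewrite wE in dN N6 D6.
  have d20 := sqr_ge0 d; have N0 : N = 12 by lra.
  move: D6; rewrite /cost N0; have dd : d = 0 by apply/eqP; rewrite -sqrf_eq0 eq_le d20 andbT; lra.
  rewrite dd; have := sqr_ge0 (s - 1 / 4); have := sqr_ge0 (t - 1 / 2); lra.
have dec := cost_decomposition w d N s t b w0 w2.
have z0 : 0 < w * (2 - w) by rewrite mulr_gt0//; lra.
have s1 := sqr_ge0 (s - (3 * w + d) / (12 * w)).
have s2 := sqr_ge0 (t - N / (12 * w)).
have s3 := sqr_ge0 (b - (12 - N) / (12 * (2 - w))).
have s1' : 0 <= w / 2 * (s - (3 * w + d) / (12 * w)) ^+ 2 by apply: mulr_ge0 => //; lra.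
have s2' : 0 <= w / 2 * (t - N / (12 * w)) ^+ 2 by apply: mulr_ge0 => //; lra.
have s3' : 0 <= (1 - w / 2) * (b - (12 - N) / (12 * (2 - w))) ^+ 2 by apply: mulr_ge0 => //; lra.
pose F := (3 * w * (2 - w) - d ^+ 2) ^+ 2 - (6 * w - N) ^+ 2.
have FE : F = (3 * w * (2 - w) - d ^+ 2 - (6 * w - N)) * (3 * w * (2 - w) - d ^+ 2 + (6 * w - N)).
  by rewrite /F; ring.
have f1 : 0 <= 3 * w * (2 - w) - d ^+ 2 - (6 * w - N) by lra.
have F0 : 0 <= F by rewrite FE; apply: mulr_ge0 => //; lra.
have s4 : 0 <= F / (144 * (w * (2 - w))) by apply: divr_ge0 => //; lra.
have lowgain : axis_dist3 b s t >= 5 / 12 - gain w d / 288 by rewrite E dec -/F; clear -s1' s2' s3' s4; lra.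
have g : 100 + 94 / 100 <= gain w d by move: lowgain D6; rewrite E; move: (gain w d) (cost _ _ _ _ _ _) => g C; clear; lra.
have dz : d ^+ 2 <= 3 * w * (2 - w) by lra.
have [b1 b2 b3 b4] := gain_box w d w0 w2 dz g.
have wd : in_box w d by split; apply/andP.
have top := best3_le_box _ _ _ _ _ best wd.
rewrite -/(axis_dist3 b s t) E dec -/F in top.
have z1 : w / 2 * (s - (3 * w + d) / (12 * w)) ^+ 2 = 0 by clear -s1' s2' s3' s4 top; lra.
have z2 : w / 2 * (t - N / (12 * w)) ^+ 2 = 0 by clear -s1' s2' s3' s4 top; lra.
have z3 : (1 - w / 2) * (b - (12 - N) / (12 * (2 - w))) ^+ 2 = 0 by clear -s1' s2' s3' s4 top; lra.
have z4 : F / (144 * (w * (2 - w))) = 0 by clear -s1' s2' s3' s4 top; lra.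
have w2n : w / 2 != 0 by apply: lt0r_neq0; clear -w0; lra.
have w2n' : 1 - w / 2 != 0 by apply: lt0r_neq0; clear -w2; lra.
have /eqP := z1; rewrite mulf_eq0 (negbTE w2n) sqrf_eq0 subr_eq0 /= => /eqP sE.
have /eqP := z2; rewrite mulf_eq0 (negbTE w2n) sqrf_eq0 subr_eq0 /= => /eqP tE.
have /eqP := z3; rewrite mulf_eq0 (negbTE w2n') sqrf_eq0 subr_eq0 /= => /eqP bE.
have NE : N = 3 * w ^+ 2 + d ^+ 2.
  have F00 : F = 0.
    apply/eqP; have /eqP := z4; rewrite mulf_eq0 => /orP[//|].
    by rewrite invr_eq0 gt_eqF// mulr_gt0.
  clear -F00 FE b1 b2 b3 b4 f1 dN N6.
  move: F00; rewrite FE => /eqP; rewrite mulf_eq0 => /orP[/eqP|/eqP]; first by lra.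
  have : 0 < 3 * w * (2 - w) - d ^+ 2 by nra.
  by lra.
exists w, d => /=; rewrite -NE; split => //.
  split => // w' d' wd'; have := best3_le_box _ _ _ _ _ best wd'.
  rewrite -/(axis_dist3 b s t); move: lowgain; clear; lra.
by rewrite E dec z1 z2 z3 -/F z4 !addr0.
Qed.

End optimal_symmetric_triples.

(** * Symmetric optimal sets *)

(** A moved point brings its image along, and the remaining point is fixed or repeats one of the
    two. The second alternative is needed because the three points may coincide. *)
Lemma involution_triple (T : Type) (f : T -> T) (a b c : T) : involutive f ->
  f @` [set a; b; c] = [set a; b; c] ->
  [\/ [/\ f a = a, f b = b & f c = c],
      exists2 q, f q <> q & [set a; b; c] = [set q; q; f q] |
      exists p q, [/\ f p = p, f q <> q & [set a; b; c] = [set p; q; f q]]].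
Proof.
move=> ff E.
have im x : [set a; b; c] x -> [set a; b; c] (f x) by move=> ax; rewrite -E; exists x.
have sets (x y z : T) : (forall u, [set a; b; c] u <-> [\/ u = x, u = y | u = z]) ->
    [set a; b; c] = [set x; y; z].
  move=> H; apply/seteqP; split => u.
    by move=> /H[]->; [left; left|left; right|right].
  by move=> [[|]|] ->; apply/H; [constructor 1|constructor 2|constructor 3].
have mem u : [set a; b; c] u <-> [\/ u = a, u = b | u = c].
  split=> [[[|]|] ->|[]->]; by [constructor 1|constructor 2|constructor 3|left; left|left; right|right].
have split3 (x y z : T) : (forall u, [set a; b; c] u <-> [\/ u = x, u = y | u = z]) ->
    f x <> x -> (exists2 q, f q <> q & [set a; b; c] = [set q; q; f q]) \/
      (exists p q, [/\ f p = p, f q <> q & [set a; b; c] = [set p; q; f q]]).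
  move=> H fx.
  have third (v w : T) : (forall u, [set a; b; c] u <-> [\/ u = x, u = v | u = w]) -> v = f x ->
      (exists2 q, f q <> q & [set a; b; c] = [set q; q; f q]) \/
      (exists p q, [/\ f p = p, f q <> q & [set a; b; c] = [set p; q; f q]]).
    move=> {}H vE; have /H[fw|fw|fw] : [set a; b; c] (f w) by apply: im; apply/H; constructor 3.
    - left; exists x => //; apply: sets => u; rewrite H vE -fw ff.
      by split => -[]->; by [constructor 1|constructor 2|constructor 3].
    - left; exists x => //; apply: sets => u; rewrite H vE.
      have -> : w = x by rewrite -(ff w) fw vE ff.
      by split => -[]->; by [constructor 1|constructor 2|constructor 3].
    - right; exists w, x; split => //; apply: sets => u; rewrite H vE.
      by split => -[]->; by [constructor 1|constructor 2|constructor 3].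
  have /H[//|fy|fz] : [set a; b; c] (f x) by apply: im; apply/H; constructor 1.
    exact: (third y z).
  apply: (third z y) => // u; rewrite H.
  by split => -[]->; by [constructor 1|constructor 2|constructor 3].
have perm1 u : [set a; b; c] u <-> [\/ u = b, u = a | u = c].
  by rewrite mem; split => -[]->; by [constructor 1|constructor 2|constructor 3].
have perm2 u : [set a; b; c] u <-> [\/ u = c, u = a | u = b].
  by rewrite mem; split => -[]->; by [constructor 1|constructor 2|constructor 3].
have [fa|/(split3 _ _ _ mem)[]] := pselect (f a = a); last by constructor 3.
  have [fb|/(split3 _ _ _ perm1)[]] := pselect (f b = b); last by constructor 3.
    have [fc|/(split3 _ _ _ perm2)[]] := pselect (f c = c); last by constructor 3.
      by constructor 1.
    by constructor 2.
  by constructor 2.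
by constructor 2.
Qed.

Section symmetric_optimal_sets.
Context {R : realType}.
Implicit Types (b s t w d : R) (a c p q z : R * R) (alpha : set (R * R)).

Lemma best3_set a c z a' c' z' : [set a; c; z] = [set a'; c'; z'] ->
  best3 a c z -> best3 a' c' z'.
Proof.
move=> E best x y w; apply: le_trans (best x y w).
have D : ((dist3 a' c' z')%:E = (dist3 a c z)%:E)%E.
  apply: etrans (esym (distortion3 a' c' z')) _.
  by rewrite -E; exact: distortion3.
by have -> : dist3 a' c' z' = dist3 a c z by exact: EFin_inj D.
Qed.

Lemma best3_swap a c z : best3 a c z -> best3 (refl_diag a) (refl_diag c) (refl_diag z).
Proof. by move=> best x y w; rewrite dist3_swap; exact: best. Qed.

Lemma best3_flip a c z :
  best3 a c z -> best3 (refl_horiz a) (refl_horiz c) (refl_horiz z).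
Proof. by move=> best x y w; rewrite dist3_flip; exact: best. Qed.

Lemma best3_not_collinear a c z (u v w : R) : 0 < u ^+ 2 + v ^+ 2 -> best3 a c z ->
  u * a.1 + v * a.2 = w -> u * c.1 + v * c.2 = w -> u * z.1 + v * z.2 = w -> False.
Proof.
move=> uv0 /best3_le + aw cw zw; have := dist3_collinear _ _ _ _ _ _ uv0 aw cw zw.
move: (dist3 _ _ _) => D; lra.
Qed.

Definition axis_set b s t : set (R * R) := [set (1 / 2, b); (1 / 2 - s, t); (1 / 2 + s, t)].

(** Three fixed points, a two-point set, and a pair at the height of the axis point are all
    collinear, which optimality excludes. *)
Lemma vert_best3 a c z : best3 a c z ->
  (@refl_vert R) @` [set a; c; z] = [set a; c; z] ->
  exists b s t, [/\ 0 < s, b != t & [set a; c; z] = axis_set b s t].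
Proof.
move=> best sym; have vertK : involutive (@refl_vert R).
  by case=> x y; rewrite /refl_vert /= subKr.
case: (involution_triple _ _ _ _ _ vertK sym).
- have half x : refl_vert x = x -> 1 * x.1 + 0 * x.2 = 1 / 2.
    by case: x => x y [] /=; lra.
  move=> [/half fa /half fc /half fz].
  by case: (best3_not_collinear _ _ _ 1 0 (1 / 2) _ best fa fc fz); lra.
- move=> [q _ E]; have := best3_set _ _ _ _ _ _ E best => bq.
  case: (best3_not_collinear _ _ _ 0 1 q.2 _ bq); rewrite ?mul0r ?mul1r ?add0r//.
move=> [p [q [fp fq E]]].
have p1 : p.1 = 1 / 2 by case: p fp {E} => x y [] /=; lra.
have q1 : q.1 != 1 / 2.
  by apply/eqP => q1; apply: fq; case: q q1 {E} => x y /= ->; rewrite /refl_vert /=; congr pair; field.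
have pq : p.2 != q.2.
  apply/eqP => pq; have bq := best3_set _ _ _ _ _ _ E best.
  case: (best3_not_collinear _ _ _ 0 1 q.2 _ bq); rewrite ?mul0r ?mul1r ?add0r//.
have pE : p = (1 / 2, p.2) by rewrite -p1; case: (p).
have [q1lt|q1gt] := ltP q.1 (1 / 2).
  exists p.2, (1 / 2 - q.1), q.2; split => //; first by lra.
  rewrite E {1}pE /axis_set; congr [set _; _; _].
    by rewrite [LHS]surjective_pairing; congr pair; ring.
  by rewrite /refl_vert; congr pair; field.
exists p.2, (q.1 - 1 / 2), q.2; split => //; first by rewrite subr_gt0 lt_neqAle eq_sym q1.
rewrite E {1}pE /axis_set -setUA [[set q] `|` _]setUC setUA; congr [set _; _; _].
  by rewrite /refl_vert; congr pair; field.
by rewrite [LHS]surjective_pairing; congr pair; ring.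
Qed.

Lemma diag_best3 a c z : best3 a c z ->
  (@refl_diag R) @` [set a; c; z] = [set a; c; z] -> False.
Proof.
move=> best sym; have diagK : involutive (@refl_diag R) by case.
case: (involution_triple _ _ _ _ _ diagK sym).
- have half x : refl_diag x = x -> 1 * x.1 + (-1) * x.2 = 0.
    by case: x => x y [] /=; lra.
  move=> [/half fa /half fc /half fz].
  by case: (best3_not_collinear _ _ _ 1 (-1) 0 _ best fa fc fz); lra.
- move=> [q _ E]; have := best3_set _ _ _ _ _ _ E best => bq.
  case: (best3_not_collinear _ _ _ 1 1 (q.1 + q.2) _ bq); rewrite ?mul1r//=; lra.
move=> [[x y] [[q1 q2] [[yx _] fq E]]]; rewrite {}yx in E.
have bq := best3_set _ _ _ _ _ _ E best; have := best3_le _ _ _ bq.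
have q12 : q1 != q2 by apply/eqP => q12; apply: fq; rewrite q12.
rewrite /refl_diag /=; have [q21|q21] := ltP q2 q1.
  have := diag_dist3_ge x q1 q2 q21; rewrite /diag_dist3.
  move: (dist3 _ _ _) => D; lra.
have {}q21 : q1 < q2 by rewrite lt_neqAle q12.
have := diag_dist3_ge x q2 q1 q21; rewrite /diag_dist3.
have b' : best3 (x, x) (q2, q1) (q1, q2).
  apply: best3_set bq; rewrite /refl_diag /=.
  by rewrite -!setUA [[set (q1, q2)] `|` _]setUC.
have -> : dist3 (x, x) (q1, q2) (q2, q1) = dist3 (x, x) (q2, q1) (q1, q2).
  by apply/le_anti/andP; split; [exact: bq|exact: b'].
move: (dist3 _ _ _) => D; lra.
Qed.

End symmetric_optimal_sets.

(** * The four optimal sets *)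

Section classification.
Context {R : realType}.
Implicit Types (b s t w d : R) (a c p q z : R * R) (alpha : set (R * R)).

Definition axis_opt b s t : Prop :=
  [/\ 0 < s, t < b & best3 (1 / 2, b) (1 / 2 - s, t) (1 / 2 + s, t)].

(** An optimal triple is recovered from its maximizer of [gain], whose uniqueness therefore passes
    to the triple. *)
Lemma axis_opt_unique b s t b' s' t' : axis_opt b s t -> axis_opt b' s' t' ->
  [/\ b = b', s = s' & t = t'].
Proof.
move=> [s0 tb best] [s0' tb' best'].
have [w [d [wd sE tE bE _]]] := axis_best b s t (ltW s0) tb best.
have [w' [d' [wd' sE' tE' bE' _]]] := axis_best b' s' t' (ltW s0') tb' best'.
have [ww dd] := box_max_unique _ _ _ _ wd wd'.
by rewrite sE tE bE sE' tE' bE' ww dd.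
Qed.

Lemma image_set3 (T U : Type) (f : T -> U) (x y z : T) :
  f @` [set x; y; z] = [set f x; f y; f z].
Proof. by rewrite !image_setU !image_set1. Qed.

Lemma vert_classification a c z : best3 a c z ->
  (@refl_vert R) @` [set a; c; z] = [set a; c; z] ->
  exists b s t, axis_opt b s t /\
    ([set a; c; z] = axis_set b s t \/ [set a; c; z] = axis_set (1 - b) s (1 - t)).
Proof.
move=> best sym; have [b [s [t [s0 bt E]]]] := vert_best3 _ _ _ best sym.
have best' := best3_set _ _ _ _ _ _ E best.
have [tb|tb] := ltP t b; first by exists b, s, t; split; [split|left].
exists (1 - b), s, (1 - t); split; last by right; rewrite !subKr.
split; [exact: s0|by rewrite ltrD2l ltrN2 lt_neqAle bt|exact: best3_flip best'].
Qed.

(** The flip turns the antidiagonal into the diagonal, which is excluded, and the swap turns the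
    horizontal axis into the vertical one. *)
Lemma optimal_classification alpha : optimal_set 3 (unif_square R) alpha ->
  square_symmetric alpha -> exists b s t, axis_opt b s t /\
  [\/ alpha = axis_set b s t, alpha = axis_set (1 - b) s (1 - t),
      alpha = (@refl_diag R) @` axis_set b s t |
      alpha = (@refl_diag R) @` axis_set (1 - b) s (1 - t)].
Proof.
move=> /optimal_set3P[a [c [z [-> best]]]] [] sym.
- by have := diag_best3 _ _ _ best sym.
- have := diag_best3 _ _ _ (best3_flip _ _ _ best).
  rewrite -(image_set3 _ _ (@refl_horiz R)) -{2}sym !image_comp => H; case: H.
  by congr image; apply/funext => -[x y]; rewrite /refl_diag /refl_horiz /refl_antidiag /= subKr.
- have [b [s [t [H E]]]] := vert_classification _ _ _ best sym.
  by exists b, s, t; split => //; case: E => ->; [constructor 1|constructor 2].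
- have := vert_classification _ _ _ (best3_swap _ _ _ best).
  rewrite -(image_set3 _ _ (@refl_diag R)) -{2}sym !image_comp => H.
  have [|b [s [t [opt E]]]] := H.
    by congr image; apply/funext => -[x y].
  exists b, s, t; split => //.
  have swK (A : set (R * R)) : (@refl_diag R) @` ((@refl_diag R) @` A) = A.
    rewrite image_comp (_ : _ \o _ = id) ?image_id//.
    by apply/funext => -[x y].
  by rewrite -(swK [set a; c; z]); case: E => ->; [constructor 3|constructor 4].
Qed.

End classification.

Theorem theorem3p6p1 (R : realType) :
  (forall alpha : set (R * R),
      optimal_set 3 (unif_square R) alpha -> square_symmetric alpha) ->
  [/\ ([set alpha | optimal_set 3 (unif_square R) alpha] #= `I_4)%card,
      (`| quant_error 3 (unif_square R)
           - (decimal [:: 0; 6; 6; 1; 7; 9; 7]%N)%:E | < (10 ^- 7)%:E)%E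
    & exists p q r : R * R,
        [/\ optimal_set 3 (unif_square R) [set p; q; r],
            near_pt (10 ^- 6) p
              (decimal [:: 5]%N, decimal [:: 8; 0; 3; 7; 6; 4]%N),
            near_pt (10 ^- 6) q
              (decimal [:: 2; 3; 1; 5; 9; 1]%N, decimal [:: 3; 1; 7; 2; 8; 5]%N)
          & near_pt (10 ^- 6) r
              (decimal [:: 7; 6; 8; 4; 0; 9]%N,
               decimal [:: 3; 1; 7; 2; 8; 5]%N)]].
Proof.
move=> sym.
have [b [s [t opt]]] : exists b s t : R, axis_opt b s t.
  have [a [c [z best]]] := exists_best3 (R := R).
  have o : optimal_set 3 (unif_square R) [set a; c; z].
    by apply/optimal_set3P; exists a, c, z.
  have [b [s [t [opt _]]]] := optimal_classification _ o (sym _ o).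
  by exists b, s, t.
have [s0 tb best] := opt.
have [w [d [wd sE tE bE VE]]] := axis_best b s t (ltW s0) tb best.
have [sN tN bN] := box_max_coordinates w d wd.
rewrite -sE -tE -bE in sN tN bN.
have [_ _ gN] := box_max_approx w d wd.
clear sE tE bE wd.
move: sN tN bN; rewrite !ltr_norml => /andP[sN1 sN2] /andP[tN1 tN2] /andP[bN1 bN2].
have bestF : best3 (1 / 2, 1 - b) (1 / 2 - s, 1 - t) (1 / 2 + s, 1 - t).
  exact: best3_flip best.
split.
- have [b1 b2] : 1 / 2 < b /\ b < 1 by split; [clear -bN1|clear -bN2]; lra.
  have [t1 t2] : 0 < t /\ t < 2 / 5 by split; [clear -tN1|clear -tN2]; lra.
  clear sN1 sN2 tN1 tN2 bN1 bN2.
  pose T := axis_set b s t; pose F := axis_set (1 - b) s (1 - t).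
  have TF : T <> F.
    move=> E; have : T (1 / 2, b) by left; left.
    by rewrite E => -[[|]|] []; clear -b1 b2 t1 t2 s0; lra.
  (* The first coordinates in the swapped sets are b, t, 1 - b, 1 - t, none of which is 1/2. *)
  have TS (B : set (R * R)) : B (1 / 2, b) \/ B (1 / 2, 1 - b) ->
      B <> (@refl_diag R) @` T /\ B <> (@refl_diag R) @` F.
    by rewrite /T /F /axis_set !image_set3 /refl_diag /=; move=> [] BT; split => E;
      move: BT; rewrite E => -[[|]|] []; clear -b1 b2 t1 t2 s0; lra.
  have SSF : (@refl_diag R) @` T <> (@refl_diag R) @` F.
    rewrite /T /F /axis_set !image_set3 /refl_diag /= => E.
    have : [set (b, 1 / 2); (t, 1 / 2 - s); (t, 1 / 2 + s)] (b, 1 / 2) by left; left.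
    by rewrite E => -[[|]|] []; clear -b1 b2 t1 t2 s0; lra.
  have [TS1 TS2] : T <> (@refl_diag R) @` T /\ T <> (@refl_diag R) @` F by apply: TS; left; left; left.
  have [FS1 FS2] : F <> (@refl_diag R) @` T /\ F <> (@refl_diag R) @` F by apply: TS; right; left; left.
  pose f (i : nat) := nth set0 [:: T; F; (@refl_diag R) @` T; (@refl_diag R) @` F] i.
  apply: card_esym; apply/card_set_bijP; exists f; split.
  + move=> [|[|[|[|]]]]//= _; apply/optimal_set3P.
    * by exists (1 / 2, b), (1 / 2 - s, t), (1 / 2 + s, t).
    * by exists (1 / 2, 1 - b), (1 / 2 - s, 1 - t), (1 / 2 + s, 1 - t).
    * exists (b, 1 / 2), (t, 1 / 2 - s), (t, 1 / 2 + s); split; last exact: best3_swap best.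
      by rewrite /f /= /T /axis_set image_set3.
    * exists (1 - b, 1 / 2), (1 - t, 1 / 2 - s), (1 - t, 1 / 2 + s); split; last exact: best3_swap bestF.
      by rewrite /f /= /F /axis_set image_set3.
  + move=> i j; rewrite !inE /= => i4 j4.
    by move: i j i4 j4 => [|[|[|[|i]]]] [|[|[|[|j]]]] //= _ _; rewrite /f /= => E;
      first [by case: (TF E)|by case: (TF (esym E))|by case: (TS1 E)|by case: (TS1 (esym E))
            |by case: (TS2 E)|by case: (TS2 (esym E))|by case: (FS1 E)|by case: (FS1 (esym E))
            |by case: (FS2 E)|by case: (FS2 (esym E))|by case: (SSF E)|by case: (SSF (esym E))].
  + move=> alpha /= oa.
    have [b' [s' [t' [opt' E]]]] := optimal_classification _ oa (sym _ oa).
    have [bb ss tt] := axis_opt_unique _ _ _ _ _ _ opt' opt; rewrite bb ss tt in E.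
    by case: E => ->; [exists 0%N|exists 1%N|exists 2%N|exists 3%N].
(* The error 6/10^8 at the rational point and the excess of the maximum, at most 1/10^7 divided by
   288, add up to less than 1/10^7. *)
- rewrite (quant_error3 _ _ _ best) -/(axis_dist3 b s t) VE.
  have := gain_approx (R := R); move: gN.
  move: (gain w d) (gain _ _) => g g' /andP[g1 g2]; rewrite ler_norml => /andP[a1 a2].
  rewrite -EFinB abse_EFin lte_fin /decimal /= ltr_norml; apply/andP.
  by clear -g1 g2 a1 a2; split; lra.
- exists (1 / 2, b), (1 / 2 - s, t), (1 / 2 + s, t); split.
  + by apply/optimal_set3P; exists (1 / 2, b), (1 / 2 - s, t), (1 / 2 + s, t).
  + rewrite /near_pt /decimal /= !ltr_norml; clear -bN1 bN2.
    by split; apply/andP; split; lra.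
  + rewrite /near_pt /decimal /= !ltr_norml.
    by split; [clear -sN1 sN2|clear -tN1 tN2]; apply/andP; split; lra.
  + rewrite /near_pt /decimal /= !ltr_norml.
    by split; [clear -sN1 sN2|clear -tN1 tN2]; apply/andP; split; lra.
Qed.
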